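(* Let $X$ be a complex Banach space with open unit ball $\mathbb{B}$, and fix $e\in\partial\mathbb{B}$ and $e^*\in J(e)$. Let $f\in\mathcal{S}^*_e$. Then for all $\lambda,\mu\in\mathbb{C}$, $$\left\|\Psi_e(f,\lambda,\mu)\right\|\le\max\{1,|4\lambda-3|\}.$$
   Context: Notation: $X^*$ is the dual space with pairing $\langle x,a\rangle$, $J(x)=\{x^*\in X^*:\|x^*\|=\|x\|,\ \langle x,x^*\rangle=\|x\|^2\}$. $\mathcal{A}(\mathbb{B})$ is the set of holomorphic mappings $f:\mathbb{B}\to X$ with $f(0)=0$, $Df(0)=\mathrm{Id}$. $D^kf(0)$ is the $k$-th Fréchet derivative at $0$ (bounded symmetric $k$-linear operator). Fekete–Szegő mapping: for $f\in\mathcal{A}(\mathbb{B})$ with $P_k(x)=\frac1{k!}D^kf(0)[x^k]$, $$\Psi_e(f,\lambda,\mu)=P_3(e)-\frac{\mu}{2}D^2f(0)[e,P_2(e)]-(\lambda-\mu)\langle P_2(e),e^*\rangle P_2(e).$$ $\mathcal{M}=\{h\in\mathcal{A}(\mathbb{B}):\ \mathrm{Re}\langle h(x),x^*\rangle\ge0\text{ for all }x\in\mathbb{B}\setminus\{0\},\ x^*\in J(x)\}$. $\mathcal{M}_e$ is the set of $h\in\mathcal{M}$ satisfying $\|\Psi_e(h,\lambda,\mu)\|\le2\max\{1,|2\lambda-1|\}$ for all $\lambda,\mu\in\mathbb{C}$. $\mathcal{S}^*_e$ is the set of biholomorphic mappings $f\in\mathcal{A}(\mathbb{B})$ such that the mapping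 $x\mapsto(Df(x))^{-1}[f(x)]$ belongs to $\mathcal{M}_e$. *)

(* Defs.v *)
From Stdlib Require Import Reals Lra Arith.
From Stdlib Require Import FunctionalExtensionality ProofIrrelevance ClassicalEpsilon.
From Coquelicot Require Export Coquelicot.
Open Scope R_scope.

(** * The normed space [L(U,V)] of bounded linear operators *)

Record blin (U V : NormedModule C_AbsRing) := Blin {
  blin_fun :> U -> V;
  blin_lin : is_linear blin_fun }.
Arguments Blin {U V}.
Arguments blin_fun {U V} _ _.
Arguments blin_lin {U V} _.

Lemma blin_eq {U V : NormedModule C_AbsRing} (A B : blin U V) :
  (forall u, A u = B u) -> A = B.
Proof.
destruct A as [a ha], B as [b hb]; simpl; intros H.
assert (E : a = b) by (apply functional_extensionality; exact H).
subst b; f_equal; apply proof_irrelevance.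
Qed.

Lemma is_linear_fun_plus {U V : NormedModule C_AbsRing} (A B : U -> V) :
  is_linear A -> is_linear B -> is_linear (fun u => plus (A u) (B u)).
Proof.
intros hA hB.
apply (is_linear_comp (fun u => (A u, B u)) (fun t : V * V => plus (fst t) (snd t))).
- now apply is_linear_prod.
- apply is_linear_plus.
Qed.

Lemma is_linear_fun_opp {U V : NormedModule C_AbsRing} (A : U -> V) :
  is_linear A -> is_linear (fun u => opp (A u)).
Proof. intros hA; apply (is_linear_comp A opp hA is_linear_opp). Qed.

Lemma is_linear_fun_scal {U V : NormedModule C_AbsRing} (c : C) (A : U -> V) :
  is_linear A -> is_linear (fun u => scal (c : C_AbsRing) (A u)).
Proof.
intros hA.
apply (is_linear_comp A (fun v => scal (c : C_AbsRing) v) hA).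
apply is_linear_scal_r; intros n m; apply Cmult_comm.
Qed.

Definition blin_zero {U V : NormedModule C_AbsRing} : blin U V :=
  Blin (fun _ : U => zero) is_linear_zero.
Definition blin_plus {U V : NormedModule C_AbsRing} (A B : blin U V) : blin U V :=
  Blin _ (is_linear_fun_plus A B (blin_lin A) (blin_lin B)).
Definition blin_opp {U V : NormedModule C_AbsRing} (A : blin U V) : blin U V :=
  Blin _ (is_linear_fun_opp A (blin_lin A)).
Definition blin_scal {U V : NormedModule C_AbsRing} (c : C) (A : blin U V) : blin U V :=
  Blin _ (is_linear_fun_scal c A (blin_lin A)).

Definition opnorm {U V : NormedModule C_AbsRing} (A : U -> V) : R :=
  real (Lub_Rbar (fun r => exists u : U, norm u <= 1 /\ r = norm (A u))).

Lemma opnorm_lub {U V : NormedModule C_AbsRing} (A : U -> V) : is_linear A ->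
  is_lub_Rbar (fun r => exists u : U, norm u <= 1 /\ r = norm (A u)) (opnorm A).
Proof.
intros hA; unfold opnorm.
pose proof (Lub_Rbar_correct (fun r => exists u : U, norm u <= 1 /\ r = norm (A u)))
  as [Hub Hl].
destruct (linear_norm A hA) as [M [M0 HM]].
assert (HbM : Rbar_le (Lub_Rbar (fun r => exists u : U, norm u <= 1 /\ r = norm (A u))) M).
{ apply Hl; intros r [u [u1 ->]]; simpl.
  apply Rle_trans with (1 := HM u).
  rewrite <- (Rmult_1_r M) at 2; apply Rmult_le_compat_l; lra. }
assert (Hb0 : Rbar_le 0 (Lub_Rbar (fun r => exists u : U, norm u <= 1 /\ r = norm (A u)))).
{ apply Hub; exists zero; split; [rewrite norm_zero; lra|].
  now rewrite (linear_zero A hA), norm_zero. }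
destruct (Lub_Rbar _) as [l| |]; simpl in *; try contradiction.
now split.
Qed.

Lemma opnorm_ge_0 {U V : NormedModule C_AbsRing} (A : U -> V) :
  is_linear A -> 0 <= opnorm A.
Proof.
intros hA; apply (proj1 (opnorm_lub A hA)).
exists zero; split; [rewrite norm_zero; lra|].
now rewrite (linear_zero A hA), norm_zero.
Qed.

Lemma opnorm_le {U V : NormedModule C_AbsRing} (A : U -> V) (M : R) :
  is_linear A -> 0 <= M ->
  (forall u, norm (A u) <= M * norm u) -> opnorm A <= M.
Proof.
intros hA M0 H; apply (proj2 (opnorm_lub A hA) M).
intros r [u [u1 ->]]; simpl.
apply Rle_trans with (1 := H u).
rewrite <- (Rmult_1_r M) at 2; now apply Rmult_le_compat_l.
Qed.

Lemma opnorm_bound {U V : NormedModule C_AbsRing} (A : U -> V) (u : U) :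
  is_linear A -> norm (A u) <= opnorm A * norm u.
Proof.
intros hA.
destruct (Rle_lt_or_eq_dec _ _ (norm_ge_0 u)) as [Hu|Hu].
- set (c := RtoC (/ norm u)).
  assert (Hc : Cmod c = / norm u).
  { unfold c; rewrite Cmod_R; apply Rabs_pos_eq; left; now apply Rinv_0_lt_compat. }
  assert (H1 : norm (A (scal (c : C_AbsRing) u)) <= opnorm A).
  { apply (proj1 (opnorm_lub A hA)); exists (scal (c : C_AbsRing) u); split; [|easy].
    apply Rle_trans with (1 := norm_scal (c : C_AbsRing) u).
    change (abs (c : C_AbsRing)) with (Cmod c); rewrite Hc, Rinv_l; lra. }
  assert (E : A u = scal (RtoC (norm u) : C_AbsRing) (A (scal (c : C_AbsRing) u))).
  { rewrite (linear_scal A hA), scal_assoc.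
    replace (mult (RtoC (norm u) : C_AbsRing) (c : C_AbsRing)) with (one : C_AbsRing).
    - now rewrite scal_one.
    - change (RtoC 1 = Cmult (RtoC (norm u)) (RtoC (/ norm u))).
      rewrite <- RtoC_mult, Rinv_r; [easy|lra]. }
  rewrite E.
  apply Rle_trans with (1 := norm_scal (RtoC (norm u) : C_AbsRing) _).
  change (abs (RtoC (norm u) : C_AbsRing)) with (Cmod (RtoC (norm u))).
  rewrite Cmod_R, Rabs_pos_eq by lra.
  rewrite Rmult_comm; apply Rmult_le_compat_r; lra.
- rewrite (norm_eq_zero u (eq_sym Hu)), (linear_zero A hA), !norm_zero; lra.
Qed.

Definition blin_AbelianMonoid_mixin (U V : NormedModule C_AbsRing) :
  AbelianMonoid.mixin_of (blin U V).
Proof.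
apply (AbelianMonoid.Mixin _ blin_plus blin_zero).
- intros; apply blin_eq; intros u; apply plus_comm.
- intros; apply blin_eq; intros u; apply plus_assoc.
- intros; apply blin_eq; intros u; apply plus_zero_r.
Defined.

Canonical blin_AbelianMonoid (U V : NormedModule C_AbsRing) :=
  AbelianMonoid.Pack (blin U V) (blin_AbelianMonoid_mixin U V) (blin U V).

Definition blin_AbelianGroup_mixin (U V : NormedModule C_AbsRing) :
  AbelianGroup.mixin_of (blin_AbelianMonoid U V).
Proof.
apply (AbelianGroup.Mixin (blin_AbelianMonoid U V) blin_opp).
intros; apply blin_eq; intros u; apply (plus_opp_r (x u)).
Defined.

Canonical blin_AbelianGroup (U V : NormedModule C_AbsRing) :=
  AbelianGroup.Pack (blin U V)
    (AbelianGroup.Class _ _ (blin_AbelianGroup_mixin U V)) (blin U V).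

Definition blin_ModuleSpace_mixin (U V : NormedModule C_AbsRing) :
  ModuleSpace.mixin_of C_AbsRing (blin_AbelianGroup U V).
Proof.
apply (ModuleSpace.Mixin C_AbsRing (blin_AbelianGroup U V) blin_scal);
  intros; apply blin_eq; intros w; simpl.
- exact (scal_assoc (V := V) x y (u w)).
- exact (scal_one (V := V) (u w)).
- exact (scal_distr_l (V := V) x (u w) (v w)).
- exact (scal_distr_r (V := V) x y (u w)).
Defined.

Canonical blin_ModuleSpace (U V : NormedModule C_AbsRing) :=
  ModuleSpace.Pack C_AbsRing (blin U V)
    (ModuleSpace.Class _ _ _ (blin_ModuleSpace_mixin U V)) (blin U V).

Lemma opnorm_triangle {U V : NormedModule C_AbsRing} (A B : blin U V) :
  opnorm (plus A B) <= opnorm A + opnorm B.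
Proof.
apply opnorm_le.
- apply blin_lin.
- apply Rplus_le_le_0_compat; apply opnorm_ge_0, blin_lin.
- intros u; apply Rle_trans with (1 := norm_triangle (A u) (B u)).
  rewrite Rmult_plus_distr_r.
  apply Rplus_le_compat; apply opnorm_bound, blin_lin.
Qed.

Lemma opnorm_scal {U V : NormedModule C_AbsRing} (c : C_AbsRing) (A : blin U V) :
  opnorm (scal c A) <= abs c * opnorm A.
Proof.
apply opnorm_le.
- apply blin_lin.
- apply Rmult_le_pos; [apply abs_ge_0|apply opnorm_ge_0, blin_lin].
- intros u; apply Rle_trans with (1 := norm_scal c (A u)).
  rewrite Rmult_assoc; apply Rmult_le_compat_l; [apply abs_ge_0|].
  apply opnorm_bound, blin_lin.
Qed.

Lemma opnorm_eq_0 {U V : NormedModule C_AbsRing} (A : blin U V) :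
  opnorm A = 0 -> A = zero.
Proof.
intros H; apply blin_eq; intros u; apply norm_eq_zero.
apply Rle_antisym; [|apply norm_ge_0].
apply Rle_trans with (1 := opnorm_bound A u (blin_lin A)); rewrite H; lra.
Qed.

Definition blin_UniformSpace_mixin (U V : NormedModule C_AbsRing) :
  UniformSpace.mixin_of (blin U V).
Proof.
apply (UniformSpace.Mixin (blin U V) zero
         (fun A (r : R) B => opnorm (minus B A) < r)).
- intros A r; rewrite minus_eq_zero.
  apply Rle_lt_trans with 0; [|apply cond_pos].
  apply opnorm_le; [apply blin_lin|lra|].
  intros u; change (norm (zero : V) <= 0 * norm u); rewrite norm_zero; lra.
- intros A B r H; rewrite <- opp_minus.
  apply Rle_lt_trans with (2 := H).
  apply opnorm_le; [apply blin_lin|apply opnorm_ge_0, blin_lin|].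
  intros u; change (norm (opp (minus B A u)) <= opnorm (minus B A) * norm u).
  rewrite norm_opp; apply opnorm_bound, blin_lin.
- intros A B D r1 r2 H1 H2.
  rewrite (minus_trans B), plus_comm.
  apply Rle_lt_trans with (1 := opnorm_triangle _ _); lra.
Defined.

Canonical blin_UniformSpace (U V : NormedModule C_AbsRing) :=
  UniformSpace.Pack (blin U V) (blin_UniformSpace_mixin U V) (blin U V).

Canonical blin_NormedModuleAux (U V : NormedModule C_AbsRing) :=
  NormedModuleAux.Pack C_AbsRing (blin U V)
    (NormedModuleAux.Class C_AbsRing _
       (ModuleSpace.class _ (blin_ModuleSpace U V)) (blin_UniformSpace_mixin U V))
    (blin U V).

Definition blin_NormedModule_mixin (U V : NormedModule C_AbsRing) :
  NormedModule.mixin_of C_AbsRing (blin_NormedModuleAux U V).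
Proof.
apply (NormedModule.Mixin C_AbsRing (blin_NormedModuleAux U V)
         (fun A : blin U V => opnorm A) 1).
- apply opnorm_triangle.
- apply opnorm_scal.
- intros A B r H; exact H.
- intros A B r H; rewrite Rmult_1_l; exact H.
- apply opnorm_eq_0.
Defined.

Canonical blin_NormedModule (U V : NormedModule C_AbsRing) :=
  NormedModule.Pack C_AbsRing (blin U V)
    (NormedModule.Class _ _ _ (blin_NormedModule_mixin U V)) (blin U V).

(** * Fréchet derivatives *)

(** The Fréchet derivative of [F] at [x]; an arbitrary operator if there is none. *)
Definition D {U V : NormedModule C_AbsRing} (F : U -> V) (x : U) : blin U V :=
  epsilon (inhabits (zero : blin U V)) (fun L => filterdiff F (locally x) L).

(** [L^k(X; X) = L(X, L(X, ... L(X, X)))]. *)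
Fixpoint Lk (X : NormedModule C_AbsRing) (k : nat) : NormedModule C_AbsRing :=
  match k with
  | O => X
  | S k => blin_NormedModule X (Lk X k)
  end.

Fixpoint Dk {X : NormedModule C_AbsRing} (k : nat) (f : X -> X) : X -> Lk X k :=
  match k with
  | O => f
  | S k => D (Dk k f)
  end.

(** [diag k A x = A[x,...,x] = A[x^k]]. *)
Fixpoint diag {X : NormedModule C_AbsRing} (k : nat) : Lk X k -> X -> X :=
  match k with
  | O => fun A _ => A
  | S k => fun (A : blin X (Lk X k)) x => diag k (A x) x
  end.

Definition D2 {X : NormedModule C_AbsRing} (f : X -> X) (x u v : X) : X :=
  (Dk 2 f x : blin X (blin_NormedModule X X)) u v.

Definition P {X : NormedModule C_AbsRing} (f : X -> X) (k : nat) (x : X) : X :=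
  scal (RtoC (/ INR (fact k)) : C_AbsRing) (diag k (Dk k f zero) x).

(** * Holomorphic mappings *)

Definition unit_ball {X : NormedModule C_AbsRing} (x : X) : Prop := norm x < 1.

Definition holomorphic_on {X : NormedModule C_AbsRing} (W : X -> Prop) (f : X -> X) : Prop :=
  forall x, W x -> ex_filterdiff f (locally x).

Definition image {X : NormedModule C_AbsRing} (W : X -> Prop) (f : X -> X) (y : X) : Prop :=
  exists x, W x /\ f x = y.

Definition biholomorphic_on {X : NormedModule C_AbsRing} (W : X -> Prop) (f : X -> X) : Prop :=
  holomorphic_on W f /\ open (image W f) /\
  exists g : X -> X, holomorphic_on (image W f) g /\ forall x, W x -> g (f x) = x.

(** Mappings defined on the unit ball are represented by total functions whose
    values outside the ball are never used. *)
Definition class_A {X : NormedModule C_AbsRing} (f : X -> X) : Prop :=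
  holomorphic_on unit_ball f /\ f zero = zero /\ forall v, D f zero v = v.

(** The inverse in [L(V,U)] of an invertible operator. *)
Definition blin_inv {U V : NormedModule C_AbsRing} (A : blin U V) : blin V U :=
  epsilon (inhabits (zero : blin V U))
    (fun B => (forall u, B (A u) = u) /\ (forall v, A (B v) = v)).

(** * Duality, the classes of mappings and the Fekete-Szego mapping *)

Definition dual (X : NormedModule C_AbsRing) : NormedModule C_AbsRing :=
  blin_NormedModule X C_NormedModule.

Definition pairing {X : NormedModule C_AbsRing} (x : X) (a : dual X) : C :=
  (a : blin X C_NormedModule) x.

Definition J {X : NormedModule C_AbsRing} (x : X) (a : dual X) : Prop :=
  norm a = norm x /\ pairing x a = RtoC (norm x ^ 2).

Definition Psi {X : NormedModule C_AbsRing} (e : X) (es : dual X)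
    (f : X -> X) (lam mu : C) : X :=
  minus (minus (P f 3 e)
               (scal ((mu / 2)%C : C_AbsRing) (D2 f zero e (P f 2 e))))
        (scal (((lam - mu) * pairing (P f 2 e) es)%C : C_AbsRing) (P f 2 e)).

Definition class_M {X : NormedModule C_AbsRing} (h : X -> X) : Prop :=
  class_A h /\
  forall (x : X) (xs : dual X), unit_ball x -> x <> zero -> J x xs ->
    0 <= Re (pairing (h x) xs).

Definition class_Me {X : NormedModule C_AbsRing} (e : X) (es : dual X) (h : X -> X) : Prop :=
  class_M h /\
  forall lam mu : C, norm (Psi e es h lam mu) <= 2 * Rmax 1 (Cmod (2 * lam - 1)).

Definition class_Se {X : NormedModule C_AbsRing} (e : X) (es : dual X) (f : X -> X) : Prop :=
  class_A f /\ biholomorphic_on unit_ball f /\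
  class_Me e es (fun x => blin_inv (D f x) (f x)).

(* Main.v *)
(** Write [h = Df^{-1} f], that is [Df(x)[h(x)] = f(x)]. Differentiating this identity two and
    three times at [0] gives [D^2h(0) = - D^2f(0)] and
    [D^3h(0)[e^3] = - 2 D^3f(0)[e^3] + 3 D^2f(0)[e, D^2f(0)[e^2]]], whence
    [Psi_e(f,lambda,mu) = - 1/2 Psi_e(h, 2 - 2 lambda, 2 - 2 mu)], and the bound defining [M_e]
    gives the claim.

    The derivatives exist because a mapping which is once complex differentiable on an open set has
    a complex differentiable derivative, in operator norm. This follows from Cauchy's estimate
    [||DF(x)|| <= 2 M / r] alone: applied to [F(y + w) - F(y)] it makes [DF] Lipschitz, and
    applied to [F(y + v + w) - F(y + v) - F(y + w) + F(y)] and to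
    [F(y + cw) - F(y) - c (F(y + w) - F(y))] it makes [w |-> DF(x + w) - DF(x)] linear up to a
    quadratic error. Cauchy's estimate comes from the mean value property of
    [(g(z) - g(0)) / z], which is Goursat's theorem for rectangles in the coordinate [log z]. *)

From Stdlib Require Import Reals Lra Lia Arith List.
From Stdlib Require Import FunctionalExtensionality PropExtensionality ClassicalEpsilon.
From Coquelicot Require Import Coquelicot.
Require Import Defs.
Open Scope R_scope.

(** * Linear identities in modules over [C] *)

(** Only one Fréchet derivative is assumed, whereas the identity for [h] is differentiated three
    times and brings in derivatives of [f] up to order four, the last one multiplied by [h zero].
    They live in [Lk X k], so the regularity theorem has to hold between general spaces and be
    iterated; completeness is therefore a predicate [banach], inherited by operator spaces. The
    second derivative has no candidate in advance: it is built as the limit of (DF(x + tv) - DF(x))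
    / t as t tends to 0.

    Integration is kept minimal: along a segment, a function is only ever compared with an affine
    one. The coordinate log z sends the singular point 0 of the difference quotient to infinity, so
    continuity at 0 is enough there. The subdivision argument behind Goursat's theorem, run on
    degenerate rectangles, also gives the mean value inequality for vector-valued maps.

    Biholomorphy makes Df(x) invertible at each point of the ball, which turns the definition of [h]
    into Df(x)[h(x)] = f(x). The final constant comes from 2(2 - 2 lambda) - 1 = -(4 lambda - 3),
    while the factor 1/2 cancels the 2 in the bound defining M_e. *)

Inductive mexp :=
  | MVar (n : nat) | MZero | MPlus (a b : mexp) | MOpp (a : mexp) | MScal (c : C) (a : mexp).

Fixpoint mden {V : ModuleSpace C_AbsRing} (rho : nat -> V) (a : mexp) : V :=
  match a with
  | MVar n => rho n
  | MZero => zero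
  | MPlus a b => plus (mden rho a) (mden rho b)
  | MOpp a => opp (mden rho a)
  | MScal c a => scal (c : C_AbsRing) (mden rho a)
  end.

Fixpoint mcoef (a : mexp) (i : nat) : C :=
  match a with
  | MVar n => if Nat.eqb n i then RtoC 1 else RtoC 0
  | MZero => RtoC 0
  | MPlus a b => Cplus (mcoef a i) (mcoef b i)
  | MOpp a => Copp (mcoef a i)
  | MScal c a => Cmult c (mcoef a i)
  end.

Fixpoint msum {V : ModuleSpace C_AbsRing} (rho : nat -> V) (f : nat -> C) (N : nat) : V :=
  match N with
  | O => zero
  | S N => plus (msum rho f N) (scal (f N : C_AbsRing) (rho N))
  end.

Fixpoint mbound (a : mexp) : nat :=
  match a with
  | MVar n => S n
  | MZero => O
  | MPlus a b => Nat.max (mbound a) (mbound b)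
  | MOpp a => mbound a
  | MScal _ a => mbound a
  end.

Fixpoint mcheck (a b : mexp) (N : nat) : Prop :=
  match N with
  | O => True
  | S N => mcoef a N = mcoef b N /\ mcheck a b N
  end.

Lemma msum_plus {V : ModuleSpace C_AbsRing} (rho : nat -> V) f g N :
  msum rho (fun i => Cplus (f i) (g i)) N = plus (msum rho f N) (msum rho g N).
Proof.
induction N as [|N IH]; simpl; [now rewrite plus_zero_l|].
rewrite IH.
change (Cplus (f N) (g N)) with (plus (f N : C_AbsRing) (g N)).
rewrite (scal_distr_r (f N : C_AbsRing)), <- !plus_assoc; f_equal.
rewrite !plus_assoc; f_equal; apply plus_comm.
Qed.

Lemma msum_scal {V : ModuleSpace C_AbsRing} (rho : nat -> V) (c : C) f N :
  msum rho (fun i => Cmult c (f i)) N = scal (c : C_AbsRing) (msum rho f N).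
Proof.
induction N as [|N IH]; simpl; [now rewrite scal_zero_r|].
rewrite IH, (scal_distr_l (c : C_AbsRing)); f_equal.
now rewrite (scal_assoc (c : C_AbsRing)).
Qed.

Lemma msum_ext {V : ModuleSpace C_AbsRing} (rho : nat -> V) f g N :
  (forall i, (i < N)%nat -> f i = g i) -> msum rho f N = msum rho g N.
Proof.
induction N as [|N IH]; simpl; [easy|]; intros H.
rewrite IH, (H N); [easy|lia|intros; apply H; lia].
Qed.

Lemma msum_zero {V : ModuleSpace C_AbsRing} (rho : nat -> V) N :
  msum rho (fun _ => RtoC 0) N = zero.
Proof.
induction N as [|N IH]; simpl; [easy|].
rewrite IH, plus_zero_l; apply (scal_zero_l (rho N)).
Qed.

Lemma mden_msum {V : ModuleSpace C_AbsRing} (rho : nat -> V) a N :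
  (mbound a <= N)%nat -> mden rho a = msum rho (mcoef a) N.
Proof.
revert N; induction a as [n| |a IHa b IHb|a IHa|c a IHa]; simpl; intros N HN.
- revert HN; induction N as [|N IH]; intros HN; [lia|]; simpl.
  destruct (Nat.eq_dec n N) as [->|Hn].
  + rewrite Nat.eqb_refl, (msum_ext _ _ (fun _ => RtoC 0)), msum_zero, plus_zero_l.
    * symmetry; apply (scal_one (rho N)).
    * intros i Hi; destruct (Nat.eqb_spec N i); [lia|easy].
  + rewrite IH by lia; destruct (Nat.eqb_spec n N); [easy|].
    symmetry; etransitivity; [|apply plus_zero_r]; f_equal; apply (scal_zero_l (rho N)).
- now rewrite msum_zero.
- rewrite msum_plus, (IHa N), (IHb N); [easy|lia|lia].
- rewrite (IHa N HN), <- (scal_opp_one (msum rho (mcoef a) N)).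
  rewrite <- (msum_scal rho (opp one : C_AbsRing)); apply msum_ext; intros i _.
  change (opp one : C_AbsRing) with (Copp (RtoC 1)); ring.
- now rewrite msum_scal, (IHa N).
Qed.

(** Reflection principle: both sides expand into combinations of the atoms in [l], so a vector
    identity reduces to one scalar equation per atom, which is within reach of [ring]. *)
Lemma mden_eq {V : ModuleSpace C_AbsRing} (l : list V) a b :
  mcheck a b (Nat.max (mbound a) (mbound b)) ->
  mden (fun n => nth n l zero) a = mden (fun n => nth n l zero) b.
Proof.
intros H; rewrite !(mden_msum _ _ (Nat.max (mbound a) (mbound b))) by lia.
apply msum_ext.
induction (Nat.max _ _) as [|N IH]; intros i Hi; [lia|]; destruct H as [H1 H2].
destruct (Nat.eq_dec i N) as [->|Hn]; [easy|apply IH; [easy|lia]].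
Qed.

Ltac m_index x l :=
  match l with
  | x :: _ => constr:(O)
  | _ :: ?l' => let n := m_index x l' in constr:(S n)
  end.
Ltac m_add x l :=
  match l with
  | _ => let _ := m_index x l in l
  | _ => constr:(x :: l)
  end.
Ltac m_atoms t l :=
  lazymatch t with
  | minus ?a ?b => let l' := m_atoms a l in m_atoms b l'
  | plus ?a ?b => let l' := m_atoms a l in m_atoms b l'
  | opp ?a => m_atoms a l
  | scal _ ?a => m_atoms a l
  | zero => l
  | _ => m_add t l
  end.
Ltac m_reify t l :=
  lazymatch t with
  | minus ?a ?b => let a' := m_reify a l in let b' := m_reify b l in constr:(MPlus a' (MOpp b'))
  | plus ?a ?b => let a' := m_reify a l in let b' := m_reify b l in constr:(MPlus a' b')
  | opp ?a => let a' := m_reify a l in constr:(MOpp a')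
  | scal ?c ?a => let a' := m_reify a l in constr:(MScal c a')
  | zero => constr:(MZero)
  | _ => let n := m_index t l in constr:(MVar n)
  end.
Ltac m_simpl := cbn [mcheck mcoef mbound Nat.max Nat.eqb]; repeat split.
(** Leaves the coefficient equations open, so that those involving inverses can go to [field] and
    those mixing real and complex operations to a componentwise proof. *)
Ltac module_eq V :=
  lazymatch goal with
  | |- ?x = ?y =>
    let l := m_atoms x (@nil V) in
    let l := m_atoms y l in
    let a := m_reify x l in
    let b := m_reify y l in
    refine (mden_eq (V := V) l a b _); m_simpl
  end.
Ltac module V := module_eq V; ring.

(** The axiom [norm_scal] is only an inequality; applied to the scalar 1/c and the vector cv it
    gives the reverse one. *)
Lemma norm_scal_C {V : NormedModule C_AbsRing} (c : C) (v : V) :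
  norm (scal (c : C_AbsRing) v) = Cmod c * norm v.
Proof.
apply Rle_antisym; [apply (norm_scal (c : C_AbsRing) v)|].
destruct (Ceq_dec c 0) as [->|Hc].
- rewrite Cmod_0, Rmult_0_l; apply norm_ge_0.
- assert (H := norm_scal (Cinv c : C_AbsRing) (scal (c : C_AbsRing) v)).
  change (abs (Cinv c : C_AbsRing)) with (Cmod (/ c)) in H.
  replace (scal (Cinv c : C_AbsRing) (scal (c : C_AbsRing) v)) with v in H
    by (module_eq V; field; exact Hc).
  rewrite Cmod_inv in H by exact Hc.
  assert (H0 := proj1 (Cmod_gt_0 c) Hc).
  apply Rmult_le_compat_l with (r := Cmod c) in H; [|lra].
  rewrite <- Rmult_assoc, Rinv_r, Rmult_1_l in H by lra; exact H.
Qed.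

(** * Subdivision of rectangles *)

Section Quadrisection.
Variable Q : R -> R -> R -> R -> Prop.

(** The first quarter on which [Q] fails; if [Q] holds on three of them the fourth is taken, which
    must be a failure when [Q] fails on the whole rectangle. *)
Let pick (r : (R * R) * (R * R)) : (R * R) * (R * R) :=
  let '((a, b), (c, d)) := r in
  let m := (a + b) / 2 in
  let n := (c + d) / 2 in
  if excluded_middle_informative (Q a m c n) then
    if excluded_middle_informative (Q m b c n) then
      if excluded_middle_informative (Q a m n d) then ((m, b), (n, d))
      else ((a, m), (n, d))
    else ((m, b), (c, n))
  else ((a, m), (c, n)).

Lemma nested_point (a b : nat -> R) (L : R) :
  (forall n, a n <= a (S n)) -> (forall n, b (S n) <= b n) ->
  (forall n, a n <= b n) -> (forall n, b n - a n = L * (/ 2) ^ n) ->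
  exists x, (forall n, a n <= x <= b n) /\
    forall delta, 0 < delta -> exists N, forall n, (N <= n)%nat -> b n - a n < delta.
Proof.
intros Ha Hb Hab HL.
assert (Hma : forall n k, a n <= a (n + k)%nat).
{ intros n k; induction k; [rewrite Nat.add_0_r; lra|].
  rewrite Nat.add_succ_r; specialize (Ha (n + k)%nat); lra. }
assert (Hmb : forall n k, b (n + k)%nat <= b n).
{ intros n k; induction k; [rewrite Nat.add_0_r; lra|].
  rewrite Nat.add_succ_r; specialize (Hb (n + k)%nat); lra. }
assert (Hc : forall n m, a n <= b m).
{ intros n m; apply Rle_trans with (a (n + m)%nat); [apply Hma|].
  apply Rle_trans with (1 := Hab _); rewrite Nat.add_comm; apply Hmb. }
destruct (completeness (fun r => exists n, r = a n)) as [x [Hx1 Hx2]].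
- exists (b O); intros r [n ->]; apply Hc.
- exists (a O), O; easy.
- exists x; split.
  + intros n; split; [apply Hx1; now exists n|apply Hx2; intros r [k ->]; apply Hc].
  + intros delta Hd.
    assert (HL0 : 0 <= L) by (specialize (HL O); specialize (Hab O); simpl in HL; lra).
    destruct (pow_lt_1_zero (/ 2)) with (y := delta / (L + 1)) as [N HN].
    { rewrite Rabs_pos_eq; lra. }
    { apply Rdiv_lt_0_compat; lra. }
    exists N; intros n Hn; rewrite HL; specialize (HN n Hn).
    rewrite Rabs_pos_eq in HN by (apply pow_le; lra).
    assert (0 <= (/ 2) ^ n) by (apply pow_le; lra).
    apply Rmult_lt_compat_l with (r := L + 1) in HN; [|lra].
    replace ((L + 1) * (delta / (L + 1))) with delta in HN by (field; lra).
    lra.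
Qed.

(** Compactness of the rectangle in the form of an induction: a failure of [Q] descends to a
    quarter, and the nested quarters shrink to a point around which [Q] holds. Degenerate rectangles
    are allowed, so that c = d gives the bisection of an interval. *)
Lemma quadrisection (a b c d : R) : a <= b -> c <= d ->
  (forall a' b' c' d', a <= a' -> a' <= b' -> b' <= b -> c <= c' -> c' <= d' -> d' <= d ->
    Q a' ((a' + b') / 2) c' ((c' + d') / 2) -> Q ((a' + b') / 2) b' c' ((c' + d') / 2) ->
    Q a' ((a' + b') / 2) ((c' + d') / 2) d' -> Q ((a' + b') / 2) b' ((c' + d') / 2) d' ->
    Q a' b' c' d') ->
  (forall x y, a <= x <= b -> c <= y <= d -> exists delta, 0 < delta /\
    forall a' b' c' d', a <= a' -> a' <= x <= b' -> b' <= b -> c <= c' -> c' <= y <= d' ->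
      d' <= d -> b' - a' < delta -> d' - c' < delta -> Q a' b' c' d') ->
  Q a b c d.
Proof.
intros Hab Hcd Hsplit Hloc.
destruct (excluded_middle_informative (Q a b c d)) as [|HQ]; [easy|exfalso].
set (r := fun n => Nat.iter n pick ((a, b), (c, d))).
assert (Hinv : forall n, let '((a', b'), (c', d')) := r n in
  (a <= a' /\ a' <= b' /\ b' <= b /\ c <= c' /\ c' <= d' /\ d' <= d) /\ ~ Q a' b' c' d').
{ induction n as [|n IH]; [simpl; repeat split; try easy; lra|].
  change (r (S n)) with (pick (r n)).
  destruct (r n) as [[a' b'] [c' d']]; destruct IH as [(h1 & h2 & h3 & h4 & h5 & h6) IH].
  unfold pick.
  repeat (destruct excluded_middle_informative); (split; [lra|]); try easy.
  intros HH; apply IH; now apply Hsplit. }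
assert (Hstep : forall n, let '((a', b'), (c', d')) := r n in
   let '((a'', b''), (c'', d'')) := r (S n) in
   a' <= a'' /\ b'' <= b' /\ c' <= c'' /\ d'' <= d' /\
   b'' - a'' = (b' - a') * / 2 /\ d'' - c'' = (d' - c') * / 2).
{ intros n; specialize (Hinv n); change (r (S n)) with (pick (r n)).
  destruct (r n) as [[a' b'] [c' d']]; destruct Hinv as [(h1 & h2 & h3 & h4 & h5 & h6) _].
  unfold pick; repeat (destruct excluded_middle_informative); lra. }
destruct (nested_point (fun n => fst (fst (r n))) (fun n => snd (fst (r n))) (b - a))
  as [x [Hx1 Hx2]].
{ intros n; specialize (Hstep n); destruct (r n) as [[? ?] [? ?]], (r (S n)) as [[? ?] [? ?]];
  simpl; lra. }
{ intros n; specialize (Hstep n); destruct (r n) as [[? ?] [? ?]], (r (S n)) as [[? ?] [? ?]];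
  simpl; lra. }
{ intros n; specialize (Hinv n); destruct (r n) as [[? ?] [? ?]]; simpl; lra. }
{ induction n as [|n IH]; [simpl; lra|].
  specialize (Hstep n); destruct (r n) as [[? ?] [? ?]], (r (S n)) as [[? ?] [? ?]].
  simpl in *; lra. }
destruct (nested_point (fun n => fst (snd (r n))) (fun n => snd (snd (r n))) (d - c))
  as [y [Hy1 Hy2]].
{ intros n; specialize (Hstep n); destruct (r n) as [[? ?] [? ?]], (r (S n)) as [[? ?] [? ?]];
  simpl; lra. }
{ intros n; specialize (Hstep n); destruct (r n) as [[? ?] [? ?]], (r (S n)) as [[? ?] [? ?]];
  simpl; lra. }
{ intros n; specialize (Hinv n); destruct (r n) as [[? ?] [? ?]]; simpl; lra. }
{ induction n as [|n IH]; [simpl; lra|].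
  specialize (Hstep n); destruct (r n) as [[? ?] [? ?]], (r (S n)) as [[? ?] [? ?]].
  simpl in *; lra. }
destruct (Hloc x y) as [delta [Hd H]]; [exact (Hx1 O)|exact (Hy1 O)|].
destruct (Hx2 delta Hd) as [N1 HN1], (Hy2 delta Hd) as [N2 HN2].
specialize (HN1 (N1 + N2)%nat ltac:(lia)); specialize (HN2 (N1 + N2)%nat ltac:(lia)).
specialize (Hinv (N1 + N2)%nat); specialize (Hx1 (N1 + N2)%nat); specialize (Hy1 (N1 + N2)%nat).
destruct (r (N1 + N2)%nat) as [[a' b'] [c' d']]; simpl in *.
apply (proj2 Hinv), H; lra.
Qed.

End Quadrisection.

(** * Derivatives *)

(** The approximation half of [filterdiff], with balls of the norm. Linearity of [L] is tracked
    separately, so the calculus rules below are plain estimates. *)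
Definition fder {U V : NormedModule C_AbsRing} (F : U -> V) (x : U) (L : U -> V) : Prop :=
  forall eps, 0 < eps -> exists delta, 0 < delta /\ forall u, norm u < delta ->
    norm (minus (minus (F (plus x u)) (F x)) (L u)) <= eps * norm u.

Lemma plus_minus {V : NormedModule C_AbsRing} (x y : V) : plus x (minus y x) = y.
Proof. module V. Qed.

Lemma minus_plus {V : NormedModule C_AbsRing} (x y : V) : minus (plus x y) x = y.
Proof. module V. Qed.

Lemma filterdiff_fder {U V : NormedModule C_AbsRing} (F : U -> V) (x : U) (L : U -> V) :
  filterdiff F (locally x) L <-> is_linear L /\ fder F x L.
Proof.
split.
- intros [hL H]; split; [easy|]; intros eps He.
  specialize (H x (fun P HP => HP) (mkposreal eps He)).
  apply (locally_norm_le_locally x) in H; destruct H as [delta H].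
  exists delta; split; [apply cond_pos|]; intros u Hu.
  assert (E : ball_norm x delta (plus x u)) by (change (norm (minus (plus x u) x) < delta); now rewrite minus_plus).
  specialize (H _ E).
  change (norm (minus (minus (F (plus x u)) (F x)) (L (minus (plus x u) x)))
    <= eps * norm (minus (plus x u) x)) in H.
  rewrite minus_plus in H; exact H.
- intros [hL H]; split; [easy|]; intros y Hy eps.
  apply is_filter_lim_locally_unique in Hy; subst y.
  destruct (H eps (cond_pos eps)) as [delta [Hd HH]].
  apply locally_le_locally_norm; exists (mkposreal delta Hd); intros y Hy.
  specialize (HH _ Hy); rewrite plus_minus in HH; exact HH.
Qed.

Lemma norm_minus_sym {V : NormedModule C_AbsRing} (x y : V) :
  norm (minus x y) = norm (minus y x).
Proof. now rewrite <- opp_minus, norm_opp. Qed.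

Lemma norm_minus_le {V : NormedModule C_AbsRing} (x y : V) :
  norm (minus x y) <= norm x + norm y.
Proof. unfold minus; rewrite <- (norm_opp y); apply norm_triangle. Qed.

Lemma norm_minus_triangle {V : NormedModule C_AbsRing} (x y z : V) :
  norm (minus x z) <= norm (minus x y) + norm (minus y z).
Proof. rewrite (minus_trans y); apply norm_triangle. Qed.

Lemma norm_le_plus {V : NormedModule C_AbsRing} (x y : V) :
  norm x <= norm y + norm (minus x y).
Proof. rewrite <- (plus_minus y x) at 1; apply norm_triangle. Qed.

Lemma norm_scal_RtoC {V : NormedModule C_AbsRing} (r : R) (v : V) :
  norm (scal (RtoC r : C_AbsRing) v) = Rabs r * norm v.
Proof. now rewrite norm_scal_C, Cmod_R. Qed.

Lemma le_plus_epsilon (a b k : R) :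
  0 <= k -> (forall eps, 0 < eps -> a <= b + k * eps) -> a <= b.
Proof.
intros Hk H; apply le_epsilon; intros eps He.
specialize (H (eps / (k + 1)) ltac:(apply Rdiv_lt_0_compat; lra)).
assert (k * (eps / (k + 1)) <= eps); [|lra].
apply Rmult_le_reg_r with (k + 1); [lra|].
replace (k * (eps / (k + 1)) * (k + 1)) with (k * eps) by (field; lra); nra.
Qed.

(** The bound (K + eps)(b - a) on the increment over [a, b] is additive under bisection and holds on
    short intervals around each point, so [quadrisection] with a collapsed second side applies. No
    linear functionals are involved. *)
Lemma norm_segment {V : NormedModule C_AbsRing} (phi : R -> V) (K : R) : 0 <= K ->
  (forall t, 0 <= t <= 1 -> forall eps, 0 < eps -> exists delta, 0 < delta /\
     forall s, 0 <= s <= 1 -> Rabs (s - t) < delta ->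
       norm (minus (phi s) (phi t)) <= (K + eps) * Rabs (s - t)) ->
  norm (minus (phi 1) (phi 0)) <= K.
Proof.
intros HK H; apply (le_plus_epsilon _ _ 1); [lra|]; intros eps He.
replace (K + 1 * eps) with ((K + eps) * (1 - 0)) by ring.
apply (quadrisection (fun a b c d => norm (minus (phi b) (phi a)) <= (K + eps) * (b - a))
  0 1 0 0); try lra.
- intros a b c d _ _ _ _ _ _ H1 H2 _ _.
  apply Rle_trans with (1 := norm_minus_triangle _ (phi ((a + b) / 2)) _); lra.
- intros x y Hx Hy; destruct (H x Hx eps He) as [delta [Hd HH]].
  exists delta; split; [easy|]; intros a b c d Ha Hax Hb _ _ _ Hab _.
  apply Rle_trans with (1 := norm_minus_triangle _ (phi x) _).
  rewrite (norm_minus_sym (phi x)).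
  assert (h1 := HH a ltac:(lra)); assert (h2 := HH b ltac:(lra)).
  rewrite Rabs_left1 in h1 by lra; rewrite Rabs_pos_eq in h2 by lra.
  specialize (h1 ltac:(lra)); specialize (h2 ltac:(lra)); lra.
Qed.

Lemma mean_value {U V : NormedModule C_AbsRing} (F : U -> V) (x w : U)
    (L : R -> U -> V) (K : R) : 0 <= K ->
  (forall t, 0 <= t <= 1 -> is_linear (L t) /\
     fder F (plus x (scal (RtoC t : C_AbsRing) w)) (L t) /\ norm (L t w) <= K) ->
  norm (minus (F (plus x w)) (F x)) <= K.
Proof.
intros HK H.
assert (E := norm_segment (fun t => F (plus x (scal (RtoC t : C_AbsRing) w))) K HK).
simpl in E; replace (plus x (scal (RtoC 1 : C_AbsRing) w)) with (plus x w) in E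
  by (module U).
replace (plus x (scal (RtoC 0 : C_AbsRing) w)) with x in E by (module U).
apply E; clear E; intros t Ht eps He.
destruct (H t Ht) as [hL [hF hK]].
assert (N := norm_ge_0 w).
(* Dividing by [norm w + 1] instead of [norm w] covers w = 0 as well; the same device recurs
   below. *)
destruct (hF (eps / (norm w + 1))) as [delta [Hd HH]].
{ apply Rdiv_lt_0_compat; lra. }
exists (delta / (norm w + 1)); split; [apply Rdiv_lt_0_compat; lra|].
intros s Hs Hst.
assert (A := Rabs_pos (s - t)).
assert (Hu : norm (scal (RtoC (s - t) : C_AbsRing) w) < delta).
{ rewrite norm_scal_RtoC.
  apply Rle_lt_trans with (Rabs (s - t) * (norm w + 1)); [nra|].
  apply Rmult_lt_compat_r with (r := norm w + 1) in Hst; [|lra].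
  replace (delta / (norm w + 1) * (norm w + 1)) with delta in Hst by (field; lra); exact Hst. }
specialize (HH _ Hu).
replace (plus (plus x (scal (RtoC t : C_AbsRing) w)) (scal (RtoC (s - t) : C_AbsRing) w))
  with (plus x (scal (RtoC s : C_AbsRing) w)) in HH
  by (module_eq U; rewrite ?RtoC_minus; ring).
apply Rle_trans with (1 := norm_le_plus _ (L t (scal (RtoC (s - t) : C_AbsRing) w))).
apply Rle_trans with (Rabs (s - t) * K + eps / (norm w + 1) * (Rabs (s - t) * norm w)).
- apply Rplus_le_compat.
  + rewrite (linear_scal _ hL), norm_scal_RtoC; now apply Rmult_le_compat_l.
  + rewrite <- norm_scal_RtoC; exact HH.
- assert (eps / (norm w + 1) * norm w <= eps); [|nra].
  apply Rmult_le_reg_r with (norm w + 1); [lra|].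
  replace (eps / (norm w + 1) * norm w * (norm w + 1)) with (eps * norm w) by (field; lra); nra.
Qed.

(** Has the shape of the conclusion of [linear_norm], which therefore proves it for every linear
    map. *)
Definition bounded_op {U V : NormedModule C_AbsRing} (L : U -> V) : Prop :=
  exists A, 0 < A /\ forall u, norm (L u) <= A * norm u.

Lemma fder_lipschitz {U V : NormedModule C_AbsRing} (F : U -> V) x L :
  fder F x L -> bounded_op L -> exists A delta, 0 < A /\ 0 < delta /\
    forall u, norm u < delta -> norm (minus (F (plus x u)) (F x)) <= A * norm u.
Proof.
intros H [A [HA HL]].
destruct (H 1 Rlt_0_1) as [delta [Hd HH]].
exists (A + 1), delta; repeat split; try lra; intros u Hu.
apply Rle_trans with (1 := norm_le_plus _ (L u)).
specialize (HH u Hu); specialize (HL u); lra.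
Qed.

Lemma fder_ext_loc {U V : NormedModule C_AbsRing} (F G : U -> V) x L r : 0 < r ->
  (forall u, norm u < r -> F (plus x u) = G (plus x u)) -> fder F x L -> fder G x L.
Proof.
intros Hr E H eps He; destruct (H eps He) as [delta [Hd HH]].
exists (Rmin r delta); split; [now apply Rmin_pos|]; intros u Hu.
assert (Hu1 := Rlt_le_trans _ _ _ Hu (Rmin_l _ _)).
assert (Hu2 := Rlt_le_trans _ _ _ Hu (Rmin_r _ _)).
rewrite <- (E u Hu1).
assert (E0 : F x = G x).
{ rewrite <- (plus_zero_r x); apply E; now rewrite norm_zero. }
rewrite <- E0; now apply HH.
Qed.

Lemma fder_plus {U V : NormedModule C_AbsRing} (F G : U -> V) x L M :
  fder F x L -> fder G x M -> fder (fun y => plus (F y) (G y)) x (fun u => plus (L u) (M u)).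
Proof.
intros H1 H2 eps He.
destruct (H1 (eps / 2) ltac:(lra)) as [d1 [Hd1 HH1]].
destruct (H2 (eps / 2) ltac:(lra)) as [d2 [Hd2 HH2]].
exists (Rmin d1 d2); split; [now apply Rmin_pos|]; intros u Hu.
specialize (HH1 u (Rlt_le_trans _ _ _ Hu (Rmin_l _ _))).
specialize (HH2 u (Rlt_le_trans _ _ _ Hu (Rmin_r _ _))).
match goal with |- norm ?a <= _ => replace a with
  (plus (minus (minus (F (plus x u)) (F x)) (L u)) (minus (minus (G (plus x u)) (G x)) (M u)))
  by (module V) end.
apply Rle_trans with (1 := norm_triangle _ _); lra.
Qed.

Lemma fder_scal {U V : NormedModule C_AbsRing} (c : C) (F : U -> V) x L :
  fder F x L ->
  fder (fun y => scal (c : C_AbsRing) (F y)) x (fun u => scal (c : C_AbsRing) (L u)).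
Proof.
intros H eps He.
assert (N := Cmod_ge_0 c).
destruct (H (eps / (Cmod c + 1))) as [d [Hd HH]]; [apply Rdiv_lt_0_compat; lra|].
exists d; split; [easy|]; intros u Hu.
match goal with |- norm ?a <= _ => replace a with
  (scal (c : C_AbsRing) (minus (minus (F (plus x u)) (F x)) (L u))) by (module V) end.
rewrite norm_scal_C; specialize (HH u Hu).
assert (Hn := norm_ge_0 u).
apply Rle_trans with (Cmod c * (eps / (Cmod c + 1) * norm u)); [now apply Rmult_le_compat_l|].
assert (Cmod c * (eps / (Cmod c + 1)) <= eps); [|nra].
apply Rmult_le_reg_r with (Cmod c + 1); [lra|].
replace (Cmod c * (eps / (Cmod c + 1)) * (Cmod c + 1)) with (Cmod c * eps) by (field; lra); nra.
Qed.

Lemma fder_minus {U V : NormedModule C_AbsRing} (F G : U -> V) x L M :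
  fder F x L -> fder G x M ->
  fder (fun y => minus (F y) (G y)) x (fun u => minus (L u) (M u)).
Proof.
intros H1 H2 eps He.
destruct (fder_plus _ _ _ _ _ H1 (fder_scal (-1)%C _ _ _ H2) eps He) as [d [Hd HH]].
exists d; split; [easy|]; intros u Hu; specialize (HH u Hu).
match goal with |- norm ?a <= _ => match type of HH with norm ?b <= _ =>
  replace a with b by (module V); exact HH end end.
Qed.

Lemma fder_const {U V : NormedModule C_AbsRing} (v : V) (x : U) :
  fder (fun _ => v) x (fun _ => zero).
Proof.
intros eps He; exists 1; split; [lra|]; intros u Hu; cbv beta.
match goal with |- norm ?a <= _ => replace a with (@zero (NormedModule.AbelianMonoid _ V))
  by (module V) end.
rewrite norm_zero; apply Rmult_le_pos; [lra|apply norm_ge_0].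
Qed.

Lemma fder_comp {U V W : NormedModule C_AbsRing} (F : U -> V) (G : V -> W) x L M :
  fder F x L -> fder G (F x) M -> bounded_op L -> is_linear M ->
  fder (fun y => G (F y)) x (fun u => M (L u)).
Proof.
intros H1 H2 HL HM eps He.
destruct (fder_lipschitz F x L H1 HL) as [A [d0 [HA [Hd0 HH0]]]].
destruct (linear_norm _ HM) as [B [HB HMB]].
destruct (H2 (eps / (2 * A))) as [d2 [Hd2 HH2]]; [apply Rdiv_lt_0_compat; lra|].
destruct (H1 (eps / (2 * B))) as [d1 [Hd1 HH1]]; [apply Rdiv_lt_0_compat; lra|].
exists (Rmin (Rmin d0 d1) (d2 / A)); split.
{ repeat apply Rmin_pos; try easy; now apply Rdiv_lt_0_compat. }
intros u Hu.
assert (Hu1 := Rlt_le_trans _ _ _ Hu (Rmin_l _ _)).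
assert (Hu2 := Rlt_le_trans _ _ _ Hu (Rmin_r _ _)).
assert (Hu3 := Rlt_le_trans _ _ _ Hu1 (Rmin_l _ _)).
assert (Hu4 := Rlt_le_trans _ _ _ Hu1 (Rmin_r _ _)).
specialize (HH0 u Hu3); specialize (HH1 u Hu4).
set (v := minus (F (plus x u)) (F x)) in *.
assert (Hv : norm v < d2).
{ apply Rle_lt_trans with (1 := HH0).
  apply Rmult_lt_compat_l with (r := A) in Hu2; [|easy].
  replace (A * (d2 / A)) with d2 in Hu2 by (field; lra); exact Hu2. }
specialize (HH2 v Hv).
replace (plus (F x) v) with (F (plus x u)) in HH2 by (unfold v; now rewrite plus_minus).
assert (N := norm_ge_0 u).
match goal with |- norm ?a <= _ => replace a with
  (plus (minus (minus (G (F (plus x u))) (G (F x))) (M v)) (M (minus v (L u)))) end.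
2:{ unfold minus at 3; rewrite (linear_plus _ HM), (linear_opp _ _ HM); module W. }
apply Rle_trans with (1 := norm_triangle _ _).
apply Rle_trans with (eps / (2 * A) * (A * norm u) + B * (eps / (2 * B) * norm u)).
- apply Rplus_le_compat.
  + apply Rle_trans with (1 := HH2); apply Rmult_le_compat_l; [|easy].
    left; apply Rdiv_lt_0_compat; lra.
  + apply Rle_trans with (1 := HMB _); apply Rmult_le_compat_l; [lra|easy].
- right; field; lra.
Qed.

(** At a small multiple tu the two remainders differ by t(Lu - Mu) and are each at most eps t |u|;
    dividing by t leaves 2 eps |u|. *)
Lemma fder_unique {U V : NormedModule C_AbsRing} (F : U -> V) x L M :
  is_linear L -> is_linear M -> fder F x L -> fder F x M -> forall u, L u = M u.
Proof.
intros hL hM H1 H2 u.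
assert (N := norm_ge_0 u).
assert (E : norm (minus (L u) (M u)) <= 0).
{ apply (le_plus_epsilon _ _ (2 * norm u)); [lra|]; intros eps He.
  destruct (H1 eps He) as [d1 [Hd1 HH1]], (H2 eps He) as [d2 [Hd2 HH2]].
  set (t := Rmin d1 d2 / (norm u + 1)).
  assert (Hm : 0 < Rmin d1 d2) by now apply Rmin_pos.
  assert (Ht : 0 < t) by (apply Rdiv_lt_0_compat; lra).
  assert (Hu : norm (scal (RtoC t : C_AbsRing) u) < Rmin d1 d2).
  { rewrite norm_scal_RtoC, Rabs_pos_eq by lra.
    apply Rlt_le_trans with (t * (norm u + 1)); [nra|].
    right; unfold t; field; lra. }
  specialize (HH1 _ (Rlt_le_trans _ _ _ Hu (Rmin_l _ _))).
  specialize (HH2 _ (Rlt_le_trans _ _ _ Hu (Rmin_r _ _))).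
  rewrite norm_scal_RtoC, Rabs_pos_eq in HH1, HH2 by lra.
  apply Rmult_le_reg_l with (1 := Ht).
  apply Rle_trans with (norm (minus (L (scal (RtoC t : C_AbsRing) u)) (M (scal (RtoC t : C_AbsRing) u)))).
  - rewrite (linear_scal _ hL), (linear_scal _ hM).
    rewrite <- (Rabs_pos_eq t) at 1 by lra; rewrite <- norm_scal_RtoC; right; f_equal.
    module V.
  - match type of HH1 with norm ?a <= _ => match type of HH2 with norm ?b <= _ =>
      replace (minus (L (scal (RtoC t : C_AbsRing) u)) (M (scal (RtoC t : C_AbsRing) u)))
      with (minus b a) by (module V) end end.
    apply Rle_trans with (1 := norm_minus_le _ _); lra. }
assert (Z : norm (minus (L u) (M u)) = 0) by (apply Rle_antisym; [easy|apply norm_ge_0]).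
apply norm_eq_zero in Z.
rewrite <- (plus_minus (M u) (L u)), Z; apply plus_zero_r.
Qed.

(** * Integration over the real numbers in complex Banach spaces *)

(** Completeness is a predicate because [Lk X k] is typed as a mere [NormedModule]; its completeness
    is proved by induction on k. The filter form is that of [CompleteSpace]. *)
Definition banach (V : NormedModule C_AbsRing) : Prop :=
  forall F : (V -> Prop) -> Prop, ProperFilter F -> cauchy F ->
    exists l : V, forall eps : posreal, F (ball l eps).

Section Realification.
Variables (V : NormedModule C_AbsRing) (hV : banach V).

(** [RInt] is applied in a complete normed module over the reals. The complex space is repackaged as
    one with the same carrier, addition, norm and balls, so that results about [realify] read back
    in [V] by conversion. *)
Definition real_ModuleSpace_mixin :
  ModuleSpace.mixin_of R_Ring (NormedModule.AbelianGroup C_AbsRing V).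
Proof.
apply (ModuleSpace.Mixin R_Ring (NormedModule.AbelianGroup C_AbsRing V)
  (fun r v => scal (RtoC r : C_AbsRing) v)).
- intros x y u; change (mult x y) with (x * y); rewrite RtoC_mult; module V.
- intros u; change (scal (RtoC 1 : C_AbsRing) u = u); module V.
- intros x u v; module V.
- intros x y u; change (plus x y) with (x + y); rewrite RtoC_plus; module V.
Defined.

Definition real_NormedModuleAux : NormedModuleAux R_AbsRing :=
  NormedModuleAux.Pack R_AbsRing V
    (NormedModuleAux.Class R_AbsRing V
      (ModuleSpace.Class R_Ring V (AbelianGroup.class (NormedModule.AbelianGroup C_AbsRing V))
        real_ModuleSpace_mixin)
      (UniformSpace.class (NormedModule.UniformSpace C_AbsRing V))) V.

Definition real_NormedModule_mixin : NormedModule.mixin_of R_AbsRing real_NormedModuleAux.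
Proof.
apply (NormedModule.Mixin R_AbsRing real_NormedModuleAux
  (fun v : V => norm v) (@norm_factor _ V)).
- exact (fun x y : V => norm_triangle x y).
- intros l x; right; apply (norm_scal_RtoC (V := V)).
- exact (fun x y : V => norm_compat1 x y).
- exact (fun x y : V => norm_compat2 x y).
- exact (fun x : V => norm_eq_zero x).
Defined.

Definition real_CompleteSpace_mixin :
  CompleteSpace.mixin_of (NormedModule.UniformSpace C_AbsRing V).
Proof.
apply (CompleteSpace.Mixin (NormedModule.UniformSpace C_AbsRing V)
  (fun F => epsilon (inhabits (zero : V)) (fun l => forall eps : posreal, F (ball l eps)))).
- intros F PF CF; apply (epsilon_spec (inhabits (zero : V))
    (fun l => forall eps : posreal, F (ball l eps))); now apply hV.
(* The two filters have the same members, hence are equal by extensionality, and [epsilon] picks the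
   same limit for both. *)
- intros F1 F2 H1 H2.
  replace F2 with F1; [intros eps; apply ball_center|].
  apply functional_extensionality; intros P; apply propositional_extensionality.
  split; [apply H2|apply H1].
Defined.

Definition realify : CompleteNormedModule R_AbsRing :=
  CompleteNormedModule.Pack R_AbsRing V
    (CompleteNormedModule.Class R_AbsRing V
      (NormedModule.Class R_AbsRing V (NormedModuleAux.class R_AbsRing real_NormedModuleAux)
        real_NormedModule_mixin)
      real_CompleteSpace_mixin) V.

Lemma continuous_realify (f : R -> V) t :
  (forall eps, 0 < eps -> exists delta, 0 < delta /\ forall s, Rabs (s - t) < delta ->
     norm (minus (f s) (f t)) <= eps) ->
  continuous (f : R -> realify) t.
Proof.
intros H P [eps HP].
destruct (H (eps / 2)) as [delta [Hd HH]]; [destruct eps; simpl; lra|].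
exists (mkposreal delta Hd); intros s Hs; apply HP.
apply (norm_compat1 (V := V)); apply Rle_lt_trans with (eps / 2); [now apply HH|].
destruct eps; simpl; lra.
Qed.

Definition integral (f : R -> V) (a b : R) : V := @RInt realify f a b.

(** The nearby point [s] may leave [a, b]: continuity is two-sided at the end points too, as
    [ex_RInt_continuous] asks. *)
Definition segment_continuous (f : R -> V) (a b : R) : Prop :=
  forall t, a <= t <= b -> forall eps, 0 < eps -> exists delta, 0 < delta /\
    forall s, Rabs (s - t) < delta -> norm (minus (f s) (f t)) <= eps.

Lemma is_integral (f : R -> V) a b : a <= b -> segment_continuous f a b ->
  @is_RInt realify f a b (integral f a b).
Proof.
intros Hab H; apply (RInt_correct (V := realify)), (ex_RInt_continuous (V := realify)).
intros t; rewrite Rmin_left, Rmax_right by easy; intros Ht.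
apply continuous_realify; now apply H.
Qed.

Lemma integral_chasles (f : R -> V) a b c : a <= b -> b <= c -> segment_continuous f a c ->
  integral f a c = plus (integral f a b) (integral f b c).
Proof.
intros Hab Hbc H; symmetry; apply (RInt_Chasles (V := realify)).
- exists (integral f a b); apply is_integral; [easy|].
  intros t Ht; apply H; lra.
- exists (integral f b c); apply is_integral; [easy|].
  intros t Ht; apply H; lra.
Qed.

(** The only way integrals are evaluated below: f is compared with t -> v + t w, whose integral is
    explicit. Goursat's theorem uses it with the affine approximation of K, the circle means with w
    = 0. *)
Lemma integral_affine_error (f : R -> V) a b (v w : V) M : a <= b -> segment_continuous f a b ->
  (forall t, a <= t <= b ->
     norm (minus (f t) (plus v (scal (RtoC t : C_AbsRing) w))) <= M) ->
  norm (minus (integral f a b) (plus (scal (RtoC (b - a) : C_AbsRing) v)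
    (scal (RtoC ((b * b - a * a) / 2) : C_AbsRing) w))) <= (b - a) * M.
Proof.
intros Hab Hc HM.
assert (Hi := is_integral f a b Hab Hc).
assert (Hw : @is_RInt realify (fun t => scal (RtoC t : C_AbsRing) w) a b
   (scal (RtoC ((b * b - a * a) / 2) : C_AbsRing) w)).
{ assert (E := is_RInt_derive (V := realify)
    (fun t => (scal (RtoC (t * t / 2) : C_AbsRing) w))
    (fun t => (scal (RtoC t : C_AbsRing) w)) a b).
  match type of E with _ -> _ -> is_RInt _ _ _ ?v =>
  replace (scal (RtoC ((b * b - a * a) / 2) : C_AbsRing) w) with v end.
  - apply E.
    + intros t _.
      apply (is_derive_scal_l (V := realify) (fun t : R_AbsRing => t * t / 2) t t w).
      auto_derive; [easy|field].
    + intros t _; apply (continuous_scal_l (V := realify) (fun t => t) w).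
      apply continuous_id.
  - change (minus (scal (RtoC (b * b / 2) : C_AbsRing) w)
      (scal (RtoC (a * a / 2) : C_AbsRing) w) =
      scal (RtoC ((b * b - a * a) / 2) : C_AbsRing) w).
    module_eq V; apply injective_projections; simpl; field. }
assert (Hv := is_RInt_const (V := realify) a b v).
assert (Hvw := is_RInt_plus (V := realify) _ _ _ _ _ _ Hv Hw).
assert (Hd := is_RInt_minus (V := realify) _ _ _ _ _ _ Hi Hvw).
exact (norm_RInt_le_const (V := realify) _ a b _ M Hab HM Hd).
Qed.

End Realification.

Lemma banach_complete (V : CompleteNormedModule C_AbsRing) : banach V.
Proof.
intros F PF CF; exists (lim F).
exact (complete_cauchy (T := CompleteNormedModule.CompleteSpace _ V) F PF CF).
Qed.

(** * Goursat's theorem *)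

Definition cderiv {V : NormedModule C_AbsRing} (K : C -> V) (z : C) (l : V) : Prop :=
  fder (U := C_NormedModule) K z (fun h => scal (h : C_AbsRing) l).

Lemma Cmod_le_abs (a b : R) : Cmod (a, b) <= Rabs a + Rabs b.
Proof.
replace (a, b) with (RtoC a + RtoC b * Ci)%C
  by (apply injective_projections; simpl; ring).
apply Rle_trans with (1 := Cmod_triangle _ _).
rewrite Cmod_mult, !Cmod_R, Cmod_Ci; lra.
Qed.

Lemma cderiv_bound {V : NormedModule C_AbsRing} (K : C -> V) x y l :
  cderiv K (x, y) l -> forall eps, 0 < eps -> exists delta, 0 < delta /\
    forall x' y', Rabs (x' - x) < delta -> Rabs (y' - y) < delta ->
    norm (minus (minus (K (x', y')) (K (x, y))) (scal ((x' - x, y' - y) : C_AbsRing) l))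
      <= eps * (Rabs (x' - x) + Rabs (y' - y)).
Proof.
intros H eps He; destruct (H eps He) as [d [Hd HH]].
exists (d / 2); split; [lra|]; intros x' y' Hx Hy.
assert (Hn := Cmod_le_abs (x' - x) (y' - y)).
assert (HH' := HH (x' - x, y' - y) ltac:(apply Rle_lt_trans with (1 := Hn); lra)).
change (plus (x, y) (x' - x, y' - y)) with (x + (x' - x), y + (y' - y)) in HH'.
replace (x + (x' - x)) with x' in HH' by ring.
replace (y + (y' - y)) with y' in HH' by ring.
apply Rle_trans with (1 := HH'); apply Rmult_le_compat_l; [lra|exact Hn].
Qed.

Lemma cderiv_continuous {V : NormedModule C_AbsRing} (K : C -> V) x y l :
  cderiv K (x, y) l -> forall eps, 0 < eps -> exists delta, 0 < delta /\
    forall x' y', Rabs (x' - x) < delta -> Rabs (y' - y) < delta ->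
    norm (minus (K (x', y')) (K (x, y))) <= eps.
Proof.
intros H eps He; destruct (cderiv_bound K x y l H 1 Rlt_0_1) as [d [Hd HH]].
assert (N := norm_ge_0 l).
exists (Rmin d (eps / (2 * (norm l + 1)))); split.
{ apply Rmin_pos; [easy|apply Rdiv_lt_0_compat; lra]. }
intros x' y' Hx Hy.
assert (Hx1 := Rlt_le_trans _ _ _ Hx (Rmin_l _ _)).
assert (Hx2 := Rlt_le_trans _ _ _ Hx (Rmin_r _ _)).
assert (Hy1 := Rlt_le_trans _ _ _ Hy (Rmin_l _ _)).
assert (Hy2 := Rlt_le_trans _ _ _ Hy (Rmin_r _ _)).
apply Rle_trans with (1 := norm_le_plus _ (scal ((x' - x, y' - y) : C_AbsRing) l)).
specialize (HH x' y' Hx1 Hy1); rewrite norm_scal_C.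
assert (Hn := Cmod_le_abs (x' - x) (y' - y)).
set (s := Rabs (x' - x) + Rabs (y' - y)) in *.
assert (Hs : s <= eps / (norm l + 1)).
{ replace (eps / (norm l + 1)) with
    (eps / (2 * (norm l + 1)) + eps / (2 * (norm l + 1))) by (field; lra).
  unfold s; lra. }
assert (s * (norm l + 1) <= eps).
{ apply Rmult_le_compat_r with (r := norm l + 1) in Hs; [|lra].
  replace (eps / (norm l + 1) * (norm l + 1)) with eps in Hs by (field; lra); exact Hs. }
nra.
Qed.

Section Goursat.
Variables (V : NormedModule C_AbsRing) (hV : banach V) (K : C -> V).

Let hor y a b := integral V hV (fun s => K (s, y)) a b.
Let ver x c d := integral V hV (fun t => K (x, t)) c d.

(** The integral of K(z) dz along the boundary of [a, b] x [c, d], counterclockwise: dz is ds on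
    horizontal sides and i dt on vertical ones. *)
Definition boundary_integral a b c d : V :=
  plus (minus (hor c a b) (hor d a b)) (scal (Ci : C_AbsRing) (minus (ver b c d) (ver a c d))).

Definition cdiff_on a b c d : Prop :=
  forall x y, a <= x <= b -> c <= y <= d -> exists l, cderiv K (x, y) l.

Lemma continuous_hor y a b c d : cdiff_on a b c d -> c <= y <= d ->
  segment_continuous V (fun s => K (s, y)) a b.
Proof.
intros H Hy t Ht eps He; destruct (H t y Ht Hy) as [l Hl].
destruct (cderiv_continuous K t y l Hl eps He) as [d' [Hd HH]].
exists d'; split; [easy|]; intros s Hs; apply HH; [easy|].
rewrite Rminus_diag, Rabs_R0; easy.
Qed.

Lemma continuous_ver x a b c d : cdiff_on a b c d -> a <= x <= b ->
  segment_continuous V (fun t => K (x, t)) c d.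
Proof.
intros H Hx t Ht eps He; destruct (H x t Hx Ht) as [l Hl].
destruct (cderiv_continuous K x t l Hl eps He) as [d' [Hd HH]].
exists d'; split; [easy|]; intros s Hs; apply HH; [|easy].
rewrite Rminus_diag, Rabs_R0; easy.
Qed.

Lemma boundary_integral_split a b c d : a <= b -> c <= d -> cdiff_on a b c d ->
  let m := (a + b) / 2 in let n := (c + d) / 2 in
  boundary_integral a b c d =
  plus (plus (boundary_integral a m c n) (boundary_integral m b c n))
       (plus (boundary_integral a m n d) (boundary_integral m b n d)).
Proof.
intros Hab Hcd H m n.
assert (Hm : a <= m <= b) by (unfold m; lra).
assert (Hn : c <= n <= d) by (unfold n; lra).
assert (Hh : forall y, c <= y <= d -> hor y a b = plus (hor y a m) (hor y m b)).
{ intros y Hy; apply integral_chasles; try easy; now apply continuous_hor with c d. }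
assert (Hv : forall x, a <= x <= b -> ver x c d = plus (ver x c n) (ver x n d)).
{ intros x Hx; apply integral_chasles; try easy; now apply continuous_ver with a b. }
unfold boundary_integral; rewrite !Hh, !Hv by lra; module V.
Qed.

(** The affine map z -> K(z0) + (z - z0) l has boundary integral zero, so only the deviation from it
    counts. With sides p and q it is at most eps (p + q) over a contour of length 2 (p + q), and 2
    (p + q)^2 <= 4 (p^2 + q^2). *)
Lemma boundary_integral_local a b c d x y l eps :
  a <= x <= b -> c <= y <= d -> cdiff_on a b c d -> 0 <= eps ->
  (forall x' y', a <= x' <= b -> c <= y' <= d ->
    norm (minus (minus (K (x', y')) (K (x, y))) (scal ((x' - x, y' - y) : C_AbsRing) l))
      <= eps * (Rabs (x' - x) + Rabs (y' - y))) ->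
  norm (boundary_integral a b c d) <= 4 * eps * ((b - a) ^ 2 + (d - c) ^ 2).
Proof.
intros Hx Hy H He HH.
set (M := eps * ((b - a) + (d - c))).
assert (HM : forall x' y', a <= x' <= b -> c <= y' <= d ->
  norm (minus (minus (K (x', y')) (K (x, y))) (scal ((x' - x, y' - y) : C_AbsRing) l)) <= M).
{ intros x' y' Hx' Hy'; apply Rle_trans with (1 := HH x' y' Hx' Hy').
  apply Rmult_le_compat_l; [easy|].
  apply Rplus_le_compat; apply Rabs_le; lra. }
(* On the horizontal line at height y' the affine approximation is s -> [v1 y'] + s l; on the
   vertical line at x' it is t -> [v2 x'] + t i l. *)
set (v1 := fun y' => plus (K (x, y)) (scal ((- x, y' - y) : C_AbsRing) l)).
set (v2 := fun x' => plus (K (x, y)) (scal ((x' - x, - y) : C_AbsRing) l)).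
assert (Eh : forall y', c <= y' <= d ->
  norm (minus (hor y' a b) (plus (scal (RtoC (b - a) : C_AbsRing) (v1 y'))
    (scal (RtoC ((b * b - a * a) / 2) : C_AbsRing) l))) <= (b - a) * M).
{ intros y' Hy'; apply integral_affine_error; [lra|now apply continuous_hor with c d|].
  intros t Ht; apply Rle_trans with (2 := HM t y' Ht Hy'); right; f_equal; unfold v1.
  module_eq V; apply injective_projections; simpl; ring. }
assert (Ev : forall x', a <= x' <= b ->
  norm (minus (ver x' c d) (plus (scal (RtoC (d - c) : C_AbsRing) (v2 x'))
    (scal (RtoC ((d * d - c * c) / 2) : C_AbsRing) (scal (Ci : C_AbsRing) l)))) <= (d - c) * M).
{ intros x' Hx'; apply integral_affine_error; [lra|now apply continuous_ver with a b|].
  intros t Ht; apply Rle_trans with (2 := HM x' t Hx' Ht); right; f_equal; unfold v2.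
  module_eq V; apply injective_projections; simpl; ring. }
assert (E1 := Eh c ltac:(lra)); assert (E2 := Eh d ltac:(lra)).
assert (E3 := Ev b ltac:(lra)); assert (E4 := Ev a ltac:(lra)).
match type of E1 with norm ?t1 <= _ => match type of E2 with norm ?t2 <= _ =>
match type of E3 with norm ?t3 <= _ => match type of E4 with norm ?t4 <= _ =>
  replace (boundary_integral a b c d) with
    (plus (minus t1 t2) (scal (Ci : C_AbsRing) (minus t3 t4)))
end end end end.
- apply Rle_trans with (1 := norm_triangle _ _).
  rewrite norm_scal_C, Cmod_Ci, Rmult_1_l.
  eapply Rle_trans.
  { apply Rplus_le_compat; apply norm_minus_le. }
  apply Rle_trans with (2 * ((b - a) + (d - c)) * M); [lra|].
  unfold M; assert (0 <= ((b - a) - (d - c)) ^ 2) by apply pow2_ge_0.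
  assert (0 <= eps * ((b - a) - (d - c)) ^ 2) by now apply Rmult_le_pos.
  nra.
(* The affine contributions of the four sides cancel here. *)
- unfold boundary_integral, v1, v2.
  module_eq V; apply injective_projections; simpl; field.
Qed.

(** The bound 4 eps (p^2 + q^2) on a rectangle with sides p and q is a quarter as large on each
    quarter, so four quarters restore it exactly. It thus passes through [quadrisection], and eps is
    arbitrary. *)
Theorem goursat a b c d : a <= b -> c <= d -> cdiff_on a b c d ->
  boundary_integral a b c d = zero.
Proof.
intros Hab Hcd H; apply norm_eq_zero; apply Rle_antisym; [|apply norm_ge_0].
apply (le_plus_epsilon _ _ (4 * ((b - a) ^ 2 + (d - c) ^ 2))).
{ assert (E1 := pow2_ge_0 (b - a)); assert (E2 := pow2_ge_0 (d - c)); lra. }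
intros eps He.
replace (0 + 4 * ((b - a) ^ 2 + (d - c) ^ 2) * eps)
  with (4 * eps * ((b - a) ^ 2 + (d - c) ^ 2)) by ring.
apply (quadrisection (fun a b c d =>
  norm (boundary_integral a b c d) <= 4 * eps * ((b - a) ^ 2 + (d - c) ^ 2))); try easy.
- intros a' b' c' d' h1 h2 h3 h4 h5 h6 H1 H2 H3 H4.
  rewrite boundary_integral_split by (try easy; intros x y Hx Hy; apply H; lra).
  apply Rle_trans with (1 := norm_triangle _ _).
  eapply Rle_trans; [apply Rplus_le_compat; apply norm_triangle|].
  nra.
- intros x y Hx Hy; destruct (H x y Hx Hy) as [l Hl].
  destruct (cderiv_bound K x y l Hl eps He) as [delta [Hd HH]].
  exists delta; split; [easy|]; intros a' b' c' d' h1 h2 h3 h4 h5 h6 h7 h8.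
  apply boundary_integral_local with x y l; try easy; try lra.
  + intros x' y' Hx' Hy'; apply H; lra.
  + intros x' y' Hx' Hy'; apply HH; apply Rabs_def1; lra.
Qed.

End Goursat.

(** * Cauchy's estimate *)

(** Absorbs a constant factor in the remainder and lets eps be at most 1, so that later estimates
    need not be normalised. *)
Lemma fder_suffices {U V : NormedModule C_AbsRing} (F : U -> V) x L k : 0 <= k ->
  (forall eps, 0 < eps <= 1 -> exists delta, 0 < delta /\ forall u, norm u < delta ->
    norm (minus (minus (F (plus x u)) (F x)) (L u)) <= k * eps * norm u) ->
  fder F x L.
Proof.
intros Hk H eps He.
destruct (H (Rmin 1 (eps / (k + 1)))) as [d [Hd HH]].
{ split; [apply Rmin_pos; [lra|apply Rdiv_lt_0_compat; lra]|apply Rmin_l]. }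
exists d; split; [easy|]; intros u Hu; apply Rle_trans with (1 := HH u Hu).
apply Rmult_le_compat_r; [apply norm_ge_0|].
apply Rle_trans with (k * (eps / (k + 1))).
- apply Rmult_le_compat_l; [easy|apply Rmin_r].
- apply Rmult_le_reg_r with (k + 1); [lra|].
  replace (k * (eps / (k + 1)) * (k + 1)) with (k * eps) by (field; lra); nra.
Qed.

Lemma fder_eq {U V : NormedModule C_AbsRing} (F : U -> V) x L M :
  (forall u, L u = M u) -> fder F x L -> fder F x M.
Proof. intros E; now rewrite (functional_extensionality _ _ E). Qed.

(** With increments p of F and q of G the remainder is B(p - Lu, G x) + B(F x, q - Mu) + B(p, q).
    The last term is quadratic in u, which is why delta is also at most eps. Used for scalar
    multiplication and for the evaluation of operators. *)
Lemma fder_bilinear {U V1 V2 W : NormedModule C_AbsRing} (B : V1 -> V2 -> W) (A : R)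
    (F : U -> V1) (G : U -> V2) x L M : 0 <= A ->
  (forall p p' q, B (plus p p') q = plus (B p q) (B p' q)) ->
  (forall p q q', B p (plus q q') = plus (B p q) (B p q')) ->
  (forall p q, norm (B p q) <= A * norm p * norm q) ->
  fder F x L -> fder G x M -> bounded_op L -> bounded_op M ->
  fder (fun y => B (F y) (G y)) x (fun u => plus (B (L u) (G x)) (B (F x) (M u))).
Proof.
intros HA Hl Hr HB HF HG HL HM.
destruct (fder_lipschitz F x L HF HL) as [a [d1 [Ha [Hd1 HH1]]]].
destruct (fder_lipschitz G x M HG HM) as [b [d2 [Hb [Hd2 HH2]]]].
assert (NF := norm_ge_0 (F x)); assert (NG := norm_ge_0 (G x)).
apply fder_suffices with (A * norm (G x) + A * norm (F x) + A * a * b).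
{ repeat apply Rplus_le_le_0_compat; repeat apply Rmult_le_pos; lra. }
intros eps He.
destruct (HF eps (proj1 He)) as [d3 [Hd3 HH3]], (HG eps (proj1 He)) as [d4 [Hd4 HH4]].
exists (Rmin eps (Rmin (Rmin d1 d2) (Rmin d3 d4))); split.
{ repeat apply Rmin_pos; lra. }
intros u Hu.
assert (Hu0 := Rlt_le_trans _ _ _ Hu (Rmin_l _ _)).
assert (Hu' := Rlt_le_trans _ _ _ Hu (Rmin_r _ _)).
assert (Hu12 := Rlt_le_trans _ _ _ Hu' (Rmin_l _ _)).
assert (Hu34 := Rlt_le_trans _ _ _ Hu' (Rmin_r _ _)).
specialize (HH1 u (Rlt_le_trans _ _ _ Hu12 (Rmin_l _ _))).
specialize (HH2 u (Rlt_le_trans _ _ _ Hu12 (Rmin_r _ _))).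
specialize (HH3 u (Rlt_le_trans _ _ _ Hu34 (Rmin_l _ _))).
specialize (HH4 u (Rlt_le_trans _ _ _ Hu34 (Rmin_r _ _))).
rewrite <- (plus_minus (F x) (F (plus x u))).
rewrite <- (plus_minus (G x) (G (plus x u))).
set (p := minus (F (plus x u)) (F x)) in *.
set (q := minus (G (plus x u)) (G x)) in *.
assert (E1 : B p (G x) = plus (B (L u) (G x)) (B (minus p (L u)) (G x)))
  by now rewrite <- Hl, plus_minus.
assert (E2 : B (F x) q = plus (B (F x) (M u)) (B (F x) (minus q (M u))))
  by now rewrite <- Hr, plus_minus.
match goal with |- norm ?a <= _ => replace a with
  (plus (plus (B (minus p (L u)) (G x)) (B (F x) (minus q (M u)))) (B p q)) end.
2:{ rewrite Hl, !Hr, E1, E2; module W. }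
assert (N := norm_ge_0 u).
apply Rle_trans with (1 := norm_triangle _ _).
eapply Rle_trans; [apply Rplus_le_compat_r, norm_triangle|].
apply Rle_trans with (A * (eps * norm u) * norm (G x) + A * norm (F x) * (eps * norm u)
  + A * (a * norm u) * (b * norm u)).
- apply Rplus_le_compat; [apply Rplus_le_compat|].
  + apply Rle_trans with (1 := HB _ _); apply Rmult_le_compat_r; [easy|].
    now apply Rmult_le_compat_l.
  + apply Rle_trans with (1 := HB _ _); apply Rmult_le_compat_l; [|easy].
    now apply Rmult_le_pos.
  + apply Rle_trans with (1 := HB _ _).
    apply Rmult_le_compat; [apply Rmult_le_pos; [easy|]| |now apply Rmult_le_compat_l|easy];
    apply norm_ge_0.
- assert (A * (a * norm u) * (b * norm u) <= A * a * b * eps * norm u); [|lra].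
  replace (A * (a * norm u) * (b * norm u)) with (A * a * b * norm u * norm u) by ring.
  apply Rmult_le_compat_r; [easy|]; apply Rmult_le_compat_l; [|lra].
  repeat apply Rmult_le_pos; lra.
Qed.

(** * The complex exponential and its derivative *)

Definition cexp (w : C) : C := (exp (fst w) * cos (snd w), exp (fst w) * sin (snd w)).

Lemma cexp_plus (w h : C) : cexp (w + h) = (cexp w * cexp h)%C.
Proof.
unfold cexp; simpl; rewrite exp_plus, cos_plus, sin_plus.
apply injective_projections; simpl; ring.
Qed.

Lemma Cmod_cexp (w : C) : Cmod (cexp w) = exp (fst w).
Proof.
replace (cexp w) with (RtoC (exp (fst w)) * (cos (snd w), sin (snd w)))%C
  by (apply injective_projections; simpl; ring).
rewrite Cmod_mult, Cmod_R, Rabs_pos_eq by (left; apply exp_pos).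
unfold Cmod at 1; simpl; rewrite !Rmult_1_r.
replace (cos (snd w) * cos (snd w) + sin (snd w) * sin (snd w)) with 1
  by (generalize (sin2_cos2 (snd w)); unfold Rsqr; lra).
rewrite sqrt_1; ring.
Qed.

Lemma derivable_pt_lim_0 (f : R -> R) l : derivable_pt_lim f 0 l ->
  forall eps, 0 < eps -> exists delta, 0 < delta /\ forall h, Rabs h < delta ->
    Rabs (f h - f 0 - l * h) <= eps * Rabs h.
Proof.
intros H eps He; destruct (H eps He) as [d Hd]; exists d; split; [apply cond_pos|].
intros h Hh; destruct (Req_dec h 0) as [->|Hn].
- replace (f 0 - f 0 - l * 0) with 0 by ring; rewrite Rabs_R0; lra.
- specialize (Hd h Hn Hh); rewrite Rplus_0_l in Hd.
  replace (f h - f 0 - l * h) with (((f h - f 0) / h - l) * h) by (field; easy).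
  rewrite Rabs_mult; apply Rmult_le_compat_r; [apply Rabs_pos|lra].
Qed.

Lemma cexp_remainder : forall eps, 0 < eps <= 1 -> exists delta, 0 < delta /\
  forall h, Cmod h < delta -> Cmod (cexp h - 1 - h)%C <= 12 * eps * Cmod h.
Proof.
intros eps He.
destruct (derivable_pt_lim_0 exp 1) with (eps := eps) as [d1 [Hd1 H1]]; [|lra|].
{ rewrite <- exp_0; apply derivable_pt_lim_exp. }
destruct (derivable_pt_lim_0 cos (- sin 0)) with (eps := eps) as [d2 [Hd2 H2]]; [|lra|].
{ apply derivable_pt_lim_cos. }
destruct (derivable_pt_lim_0 sin (cos 0)) with (eps := eps) as [d3 [Hd3 H3]]; [|lra|].
{ apply derivable_pt_lim_sin. }
exists (Rmin eps (Rmin d1 (Rmin d2 d3))); split; [repeat apply Rmin_pos; lra|].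
intros [a b] Hh.
assert (Ha : Rabs a <= Cmod (a, b)) by apply (re_le_Cmod (a, b)).
assert (Hb : Rabs b <= Cmod (a, b)).
{ apply Rle_trans with (2 := Rmax_Cmod (a, b)); apply Rmax_r. }
assert (h0 := Rlt_le_trans _ _ _ Hh (Rmin_l _ _)).
assert (h' := Rlt_le_trans _ _ _ Hh (Rmin_r _ _)).
assert (h1 := Rlt_le_trans _ _ _ h' (Rmin_l _ _)).
assert (h'' := Rlt_le_trans _ _ _ h' (Rmin_r _ _)).
assert (h2 := Rlt_le_trans _ _ _ h'' (Rmin_l _ _)).
assert (h3 := Rlt_le_trans _ _ _ h'' (Rmin_r _ _)).
specialize (H1 a ltac:(lra)); specialize (H2 b ltac:(lra)); specialize (H3 b ltac:(lra)).
rewrite exp_0 in H1; rewrite cos_0, sin_0 in H2; rewrite cos_0, sin_0 in H3.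
set (m := Cmod (a, b)) in *.
set (r1 := exp a - 1 - 1 * a) in *.
set (r2 := cos b - 1 - - 0 * b) in *.
set (r3 := sin b - 0 - 1 * b) in *.
assert (Hm : 0 <= m) by apply Cmod_ge_0.
assert (A0 := Rabs_pos a); assert (B0 := Rabs_pos b).
assert (H1' : Rabs r1 <= eps * m) by nra.
assert (H2' : Rabs r2 <= eps * m) by nra.
assert (H3' : Rabs r3 <= eps * m) by nra.
assert (E : Rabs (exp a) <= 3).
{ replace (exp a) with (1 + a + r1) by (unfold r1; ring).
  apply Rle_trans with (1 := Rabs_triang _ _).
  assert (T := Rabs_triang 1 a); rewrite Rabs_R1 in T; nra. }
(* Substitutes exp a = 1 + a + r1, cos b = 1 + r2 and sin b = b + r3. The four terms are at most 1,
   3, 2 and 3 times eps |h|, within the stated 12. *)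
replace (cexp (a, b) - 1 - (a, b))%C with
  (r1 + exp a * r2, (a + r1) * b + exp a * r3)
  by (apply injective_projections; unfold r1, r2, r3; simpl; ring).
apply Rle_trans with (1 := Cmod_le_abs _ _).
assert (T1 := Rabs_triang r1 (exp a * r2)); rewrite Rabs_mult in T1.
assert (T2 := Rabs_triang ((a + r1) * b) (exp a * r3)); rewrite !Rabs_mult in T2.
assert (T3 := Rabs_triang a r1).
assert (T4 : Rabs (exp a) * Rabs r2 <= 3 * (eps * m)).
{ apply Rmult_le_compat; try easy; apply Rabs_pos. }
assert (T5 : Rabs (exp a) * Rabs r3 <= 3 * (eps * m)).
{ apply Rmult_le_compat; try easy; apply Rabs_pos. }
assert (T6 : Rabs (a + r1) * Rabs b <= (2 * eps) * m).
{ apply Rmult_le_compat; try easy; [apply Rabs_pos|nra]. }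
nra.
Qed.

(** The functional equation moves the remainder at w to the remainder at 0, multiplied by e^w. *)
Lemma cexp_cderiv (w : C) : cderiv (V := C_NormedModule) cexp w (cexp w).
Proof.
apply fder_suffices with (Cmod (cexp w) * 12).
{ apply Rmult_le_pos; [apply Cmod_ge_0|lra]. }
intros eps He; destruct (cexp_remainder eps He) as [d [Hd HH]].
exists d; split; [easy|]; intros h Hh; specialize (HH h Hh).
change (Cmod (cexp (w + h) - cexp w - h * cexp w)%C <= Cmod (cexp w) * 12 * eps * Cmod h).
replace (cexp (w + h) - cexp w - h * cexp w)%C with (cexp w * (cexp h - 1 - h))%C
  by (rewrite cexp_plus; ring).
rewrite Cmod_mult; assert (N := Cmod_ge_0 (cexp w)); nra.
Qed.

Lemma bounded_scal_r {V : NormedModule C_AbsRing} (l : V) :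
  bounded_op (fun h : C_NormedModule => scal (h : C_AbsRing) l).
Proof.
exists (norm l + 1); assert (N := norm_ge_0 l); split; [lra|].
intros h; rewrite norm_scal_C; change (norm h) with (Cmod h).
assert (N' := Cmod_ge_0 h); nra.
Qed.

Lemma linear_scal_r {V : NormedModule C_AbsRing} (l : V) :
  is_linear (fun h : C_NormedModule => scal (h : C_AbsRing) l).
Proof.
split.
- intros x y; exact (scal_distr_r (x : C_AbsRing) (y : C_AbsRing) l).
- intros k x; exact (eq_sym (scal_assoc (k : C_AbsRing) (x : C_AbsRing) l)).
- apply bounded_scal_r.
Qed.

Lemma cderiv_comp {V : NormedModule C_AbsRing} (k : C -> V) (g : C -> C) w l m :
  cderiv (V := C_NormedModule) g w m -> cderiv k (g w) l ->
  cderiv (fun z => k (g z)) w (scal (m : C_AbsRing) l).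
Proof.
intros Hg Hk.
assert (H := fder_comp (U := C_NormedModule) (V := C_NormedModule) g k w _ _ Hg Hk
  (bounded_scal_r (V := C_NormedModule) m) (linear_scal_r l)).
refine (fder_eq _ _ _ _ _ H); intros h.
exact (eq_sym (scal_assoc (h : C_AbsRing) (m : C_AbsRing) l)).
Qed.

(* In the coordinate [w = log z] the circles about [0] become vertical segments; the
   horizontal sides of the rectangles between them cancel by periodicity, so that the mean
   over a circle does not depend on its radius. *)
Lemma circle_mean_bound {V : NormedModule C_AbsRing} (hV : banach V) (k : C -> V) r M :
  0 < r ->
  (forall z, 0 < Cmod z <= r -> exists l, cderiv k z l) ->
  (forall eps, 0 < eps -> exists delta, 0 < delta /\ forall z, Cmod z < delta ->
     norm (minus (k z) (k 0)) <= eps) ->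
  (forall z, Cmod z = r -> norm (k z) <= M) ->
  norm (k 0) <= M.
Proof.
intros Hr Hk H0 HM.
assert (Hpi := PI_RGT_0).
set (K := fun w => k (cexp w)).
set (s1 := ln r).
assert (Er : exp s1 = r) by now apply exp_ln.
assert (HK : forall s0, cdiff_on V K s0 s1 0 (2 * PI)).
{ intros s0 x y Hx Hy.
  destruct (Hk (cexp (x, y))) as [l Hl].
  - rewrite Cmod_cexp; simpl; split; [apply exp_pos|rewrite <- Er].
    destruct (proj2 Hx) as [h| ->]; [left; now apply exp_increasing|lra].
  - exists (scal (cexp (x, y) : C_AbsRing) l).
    apply (cderiv_comp k cexp); [apply cexp_cderiv|exact Hl]. }
assert (Hc : forall s, s <= s1 -> segment_continuous V (fun t => K (s, t)) 0 (2 * PI)).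
{ intros s Hs; apply continuous_ver with s s1; [apply HK|lra]. }
apply (le_plus_epsilon _ _ 1); [lra|]; intros eps He.
destruct (H0 eps He) as [d [Hd HH]].
(* The inner circle has radius at most d/2, where k is within eps of k(0); the minimum keeps it
   inside the outer one. *)
set (s0 := Rmin s1 (ln (d / 2))).
assert (Hs0 : s0 <= s1) by apply Rmin_l.
assert (G := goursat V hV K s0 s1 0 (2 * PI) Hs0 ltac:(lra) (HK s0)).
unfold boundary_integral in G.
replace (fun s => K (s, 2 * PI)) with (fun s => K (s, 0)) in G.
2:{ apply functional_extensionality; intros s; unfold K, cexp; simpl.
    now rewrite cos_2PI, sin_2PI, cos_0, sin_0. }
(* Comparison with 0 bounds the outer integral by 2 pi M; the next one compares the inner integral
   with that of the constant k(0). *)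
assert (E1 := integral_affine_error V hV (fun t => K (s1, t)) 0 (2 * PI) zero zero M
  ltac:(lra) (Hc s1 (Rle_refl _))).
assert (E0 := integral_affine_error V hV (fun t => K (s0, t)) 0 (2 * PI) (k 0) zero eps
  ltac:(lra) (Hc s0 Hs0)).
set (I1 := integral V hV (fun t => K (s1, t)) 0 (2 * PI)) in *.
set (I0 := integral V hV (fun t => K (s0, t)) 0 (2 * PI)) in *.
(* Both horizontal sides contribute [T], so Goursat's theorem leaves i (I1 - I0) = 0, which is
   multiplied by -i. *)
assert (EI : I0 = I1).
{ set (T := integral V hV (fun s => K (s, 0)) s0 s1) in *.
  assert (E : scal (- Ci : C_AbsRing)%C (plus (minus T T) (scal (Ci : C_AbsRing) (minus I1 I0)))
    = minus I1 I0).
  { module_eq V; apply injective_projections; simpl; ring. }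
  rewrite G in E; rewrite <- (plus_minus I0 I1), <- E; module V. }
assert (B1 : norm I1 <= 2 * PI * M).
{ match type of E1 with _ -> norm ?a <= _ => replace I1 with a by (module V) end.
  replace (2 * PI * M) with ((2 * PI - 0) * M) by ring; apply E1; intros t Ht; cbv beta.
  match goal with |- norm ?a <= _ => replace a with (K (s1, t)) by (module V) end.
  apply HM; now rewrite Cmod_cexp. }
assert (B0 : norm (minus I0 (scal (RtoC (2 * PI) : C_AbsRing) (k 0))) <= 2 * PI * eps).
{ match type of E0 with _ -> norm ?a <= _ =>
    replace (minus I0 (scal (RtoC (2 * PI) : C_AbsRing) (k 0))) with a
    by (rewrite Rminus_0_r; module V) end.
  replace (2 * PI * eps) with ((2 * PI - 0) * eps) by ring; apply E0; intros t Ht; cbv beta.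
  match goal with |- norm ?a <= _ => replace a with (minus (K (s0, t)) (k 0)) by (module V) end.
  apply HH; rewrite Cmod_cexp; change (exp s0 < d).
  apply Rle_lt_trans with (exp (ln (d / 2))); [|rewrite exp_ln by lra; lra].
  destruct (Rmin_r s1 (ln (d / 2))) as [h|h]; [left; now apply exp_increasing|].
  unfold s0; rewrite h; lra. }
assert (B : norm (scal (RtoC (2 * PI) : C_AbsRing) (k 0)) <= 2 * PI * M + 2 * PI * eps).
{ apply Rle_trans with (1 := norm_le_plus _ I0); rewrite norm_minus_sym.
  rewrite EI at 1; lra. }
rewrite norm_scal_RtoC, Rabs_pos_eq in B by lra.
apply Rmult_le_reg_l with (2 * PI); lra.
Qed.

(** The remainder is exactly h^2 / (z^2 (z + h)). For |h| < |z|/2 the last factor is at least |z|/2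
    in modulus, whence the constant 2/|z|^3. *)
Lemma cderiv_inv (z : C) : z <> 0 -> cderiv (V := C_NormedModule) Cinv z (- / (z * z))%C.
Proof.
intros Hz.
assert (Hm := proj1 (Cmod_gt_0 z) Hz).
apply fder_suffices with (2 / Cmod z ^ 3).
{ left; apply Rdiv_lt_0_compat; [lra|now apply pow_lt]. }
intros eps He; exists (Rmin eps (Cmod z / 2)); split; [apply Rmin_pos; lra|].
intros h Hh; change (norm h) with (Cmod h) in *.
assert (h1 := Rlt_le_trans _ _ _ Hh (Rmin_l _ _)).
assert (h2 := Rlt_le_trans _ _ _ Hh (Rmin_r _ _)).
assert (Hzh : Cmod z / 2 <= Cmod (z + h)%C).
{ assert (T := Cmod_triangle (z + h) (- h)); rewrite Cmod_opp in T.
  replace (z + h + - h)%C with z in T by ring; lra. }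
assert (Hn : (z + h)%C <> 0) by (intros E; rewrite E, Cmod_0 in Hzh; lra).
change (Cmod (/ (z + h) - / z - h * (- / (z * z)))%C <= 2 / Cmod z ^ 3 * eps * Cmod h).
replace (/ (z + h) - / z - h * (- / (z * z)))%C with (h * h * / (z * z) * / (z + h))%C
  by (field; now split).
rewrite !Cmod_mult, !Cmod_inv, Cmod_mult by (try easy; now apply Cmult_neq_0).
assert (N := Cmod_ge_0 h).
assert (I : / Cmod (z + h) <= 2 / Cmod z).
{ replace (2 / Cmod z) with (/ (Cmod z / 2)) by (field; lra).
  apply Rinv_le_contravar; lra. }
apply Rle_trans with (eps * Cmod h * / (Cmod z * Cmod z) * (2 / Cmod z)).
- apply Rmult_le_compat; try easy.
  + repeat apply Rmult_le_pos; try easy; left; apply Rinv_0_lt_compat; nra.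
  + left; apply Rinv_0_lt_compat; lra.
  + apply Rmult_le_compat_r; [left; apply Rinv_0_lt_compat; nra|]; nra.
- right; field; lra.
Qed.

Lemma fder_linear {U V : NormedModule C_AbsRing} (L : U -> V) x : is_linear L -> fder L x L.
Proof.
intros hL eps He; exists 1; split; [lra|]; intros u _.
rewrite (linear_plus _ hL).
match goal with |- norm ?a <= _ => replace a with (@zero (NormedModule.AbelianMonoid _ V))
  by (module V) end.
rewrite norm_zero; apply Rmult_le_pos; [lra|apply norm_ge_0].
Qed.

(** The difference quotient k, given the value l at 0, is continuous there and differentiable
    elsewhere, so [circle_mean_bound] applies. The factor 2 comes from |g(z) - g(0)| <= 2M on the
    circle. *)
Lemma cauchy_estimate_disc {V : NormedModule C_AbsRing} (hV : banach V) (g : C -> V) r M l :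
  0 < r -> (forall z, Cmod z <= r -> exists l, cderiv g z l) ->
  (forall z, Cmod z <= r -> norm (g z) <= M) -> cderiv g 0 l ->
  norm l <= 2 * M / r.
Proof.
intros Hr Hg HM Hl.
set (k := fun z => if Ceq_dec z 0 then l else scal (Cinv z : C_AbsRing) (minus (g z) (g 0))).
assert (k0 : k 0 = l) by (unfold k; destruct (Ceq_dec 0 0); easy).
rewrite <- k0; apply circle_mean_bound with r; try easy.
- intros z Hz.
  assert (Hz0 : z <> 0) by (apply Cmod_gt_0; lra).
  destruct (Hg z (proj2 Hz)) as [l' Hl'].
  assert (Hd : fder (U := C_NormedModule)
    (fun z => scal (Cinv z : C_AbsRing) (minus (g z) (g 0))) z
    (fun h => plus (scal (h * - / (z * z) : C_AbsRing)%C (minus (g z) (g 0)))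
      (scal (/ z : C_AbsRing)%C (minus (scal (h : C_AbsRing) l') zero)))).
  { apply (fder_bilinear (U := C_NormedModule) (V1 := C_NormedModule)
      (fun c v => scal (c : C_AbsRing) v) 1 Cinv (fun z => minus (g z) (g 0)) z
      (fun h => (h * - / (z * z))%C) (fun h => minus (scal (h : C_AbsRing) l') zero)).
    - lra.
    - intros p p' q; exact (scal_distr_r (p : C_AbsRing) (p' : C_AbsRing) q).
    - intros p q q'; exact (scal_distr_l (p : C_AbsRing) q q').
    - intros p q; rewrite norm_scal_C, Rmult_1_l; right; easy.
    - exact (cderiv_inv z Hz0).
    - apply (fder_minus (U := C_NormedModule)); [exact Hl'|apply (fder_const (U := C_NormedModule))].
    - exact (bounded_scal_r (V := C_NormedModule) (- / (z * z))%C).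
    - destruct (bounded_scal_r l') as [A [HA H]]; exists A; split; [easy|]; intros h.
      rewrite minus_zero_r; apply H. }
  exists (plus (scal (- / (z * z) : C_AbsRing)%C (minus (g z) (g 0)))
    (scal (/ z : C_AbsRing)%C l')).
  apply (fder_eq (U := C_NormedModule) _ _ _
    (fun h => scal (h : C_AbsRing) (plus (scal (- / (z * z) : C_AbsRing)%C (minus (g z) (g 0)))
    (scal (/ z : C_AbsRing)%C l')))) in Hd.
  2:{ intros h; module V. }
  (* The disc of radius |z| about z avoids 0, so there k is the quotient and its exceptional value
     does not interfere. *)
  refine (fder_ext_loc _ _ _ _ (Cmod z) ltac:(lra) _ Hd).
  intros u Hu; unfold k; destruct Ceq_dec as [E|]; [|easy].
  exfalso; change (norm u) with (Cmod u) in Hu.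
  change ((z + u)%C = 0) in E.
  assert (T := Cmod_triangle (z + u) (- u)); rewrite E, Cmod_opp, Cmod_0 in T.
  rewrite <- E in T at 1; replace (z + u + - u)%C with z in T by ring; lra.
- intros eps He; destruct (Hl eps He) as [d [Hd HH]]; exists d; split; [easy|].
  intros z Hz; rewrite k0; unfold k; destruct (Ceq_dec z 0) as [->|Hz0].
  + match goal with |- norm ?a <= _ => replace a with (@zero (NormedModule.AbelianMonoid _ V))
      by (module V) end.
    rewrite norm_zero; lra.
  + specialize (HH z Hz).
    change (plus (RtoC 0 : C_NormedModule) z) with (0 + z)%C in HH; rewrite Cplus_0_l in HH.
    assert (Hm := proj1 (Cmod_gt_0 z) Hz0).
    change (norm z) with (Cmod z) in HH.
    apply Rmult_le_reg_l with (1 := Hm); rewrite <- norm_scal_C, Rmult_comm with (r2 := eps).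
    match type of HH with norm ?b <= _ =>
      match goal with |- norm ?a <= _ => replace a with b end end; [exact HH|].
    module_eq V; field; easy.
- intros z Hz; unfold k; destruct (Ceq_dec z 0) as [E|Hz0].
  { rewrite E, Cmod_0 in Hz; lra. }
  rewrite norm_scal_C, Cmod_inv, Hz by easy.
  apply Rle_trans with (/ r * (2 * M)); [|right; field; lra].
  apply Rmult_le_compat_l; [left; now apply Rinv_0_lt_compat|].
  apply Rle_trans with (1 := norm_minus_le _ _).
  assert (norm (g z) <= M) by (apply HM; lra).
  assert (norm (g 0) <= M) by (apply HM; rewrite Cmod_0; lra).
  lra.
Qed.

(** Restriction to the complex line z -> F(x + zu), on the disc of radius r/|u|; its derivative at 0
    is L u. *)
Lemma cauchy_estimate {U V : NormedModule C_AbsRing} (hV : banach V) (F : U -> V) x r M L :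
  0 < r -> (forall u, norm u <= r -> exists L, is_linear L /\ fder F (plus x u) L) ->
  (forall u, norm u <= r -> norm (F (plus x u)) <= M) -> is_linear L -> fder F x L ->
  forall u, norm (L u) <= 2 * M / r * norm u.
Proof.
intros Hr HF HM hL HL u.
destruct (Rle_lt_or_eq_dec _ _ (norm_ge_0 u)) as [Hu|Hu].
2:{ rewrite (norm_eq_zero u (eq_sym Hu)), (linear_zero _ hL), !norm_zero; lra. }
assert (Hz : forall z, Cmod z <= r / norm u -> norm (scal (z : C_AbsRing) u) <= r).
{ intros z Hz; rewrite norm_scal_C.
  apply Rmult_le_compat_r with (r := norm u) in Hz; [|lra].
  replace (r / norm u * norm u) with r in Hz by (field; lra); exact Hz. }
assert (Hline : forall z L', is_linear L' -> fder F (plus x (scal (z : C_AbsRing) u)) L' ->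
  cderiv (fun z => F (plus x (scal (z : C_AbsRing) u))) z (L' u)).
{ intros z L' hL' HL'.
  assert (Hi : fder (U := C_NormedModule) (fun z => plus x (scal (z : C_AbsRing) u)) z
    (fun h => plus zero (scal (h : C_AbsRing) u))).
  { apply (fder_plus (U := C_NormedModule)); [apply (fder_const (U := C_NormedModule))|].
    apply (fder_linear (U := C_NormedModule)), linear_scal_r. }
  assert (H := fder_comp (U := C_NormedModule) _ F z _ L' Hi HL').
  refine (fder_eq _ _ _ _ _ (H _ hL')).
  - intros h; rewrite plus_zero_l; apply (linear_scal _ hL').
  - destruct (bounded_scal_r u) as [A [HA HB]]; exists A; split; [easy|]; intros h.
    rewrite plus_zero_l; apply HB. }
apply Rle_trans with (2 * M / (r / norm u)); [|right; field; lra].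
apply (cauchy_estimate_disc hV (fun z => F (plus x (scal (z : C_AbsRing) u)))).
- now apply Rdiv_lt_0_compat.
- intros z Hz'; destruct (HF _ (Hz z Hz')) as [L' [hL' HL']].
  exists (L' u); now apply Hline.
- intros z Hz'; apply HM, Hz, Hz'.
- apply Hline; [easy|].
  replace (plus x (scal (RtoC 0 : C_AbsRing) u)) with x by (module U); exact HL.
Qed.

(** * Holomorphic mappings have holomorphic derivatives *)

Lemma norm_minus_eq_0 {V : NormedModule C_AbsRing} (x y : V) : norm (minus x y) <= 0 -> x = y.
Proof.
intros H; assert (Z : norm (minus x y) = 0) by (apply Rle_antisym; [easy|apply norm_ge_0]).
apply norm_eq_zero in Z; rewrite <- (plus_minus y x), Z; apply plus_zero_r.
Qed.

(** * Limits along filters and completeness of operator spaces *)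

Lemma banach_filter_lim {T : Type} {V : NormedModule C_AbsRing} (hV : banach V)
    (F : (T -> Prop) -> Prop) (PF : ProperFilter F) (q : T -> V) :
  (forall eps, 0 < eps -> exists t, F (fun s => norm (minus (q s) (q t)) < eps)) ->
  exists l, forall eps, 0 < eps -> F (fun s => norm (minus (q s) l) < eps).
Proof.
intros H; destruct (hV (filtermap q F)) as [l Hl].
- now apply filtermap_proper_filter.
- intros eps; destruct (H eps (cond_pos eps)) as [t Ht]; exists (q t).
  unfold filtermap; revert Ht; apply filter_imp; intros s Hs; now apply norm_compat1.
- exists l; intros eps He.
  assert (N := norm_factor_gt_0 (K := C_AbsRing) (V := V)).
  assert (E : 0 < eps / @norm_factor _ V) by now apply Rdiv_lt_0_compat.
  generalize (Hl (mkposreal _ E)); unfold filtermap; apply filter_imp; intros s Hs.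
  apply norm_compat2 in Hs; simpl in Hs.
  replace (norm_factor * (eps / norm_factor)) with eps in Hs; [exact Hs|field; lra].
Qed.

(** The limit L is taken pointwise. Any finite number of conditions on A u being close to L u is met
    by a single A, since a proper filter has nonempty intersections; linearity and boundedness pass
    from such an A to L. *)
Lemma banach_blin (U V : NormedModule C_AbsRing) : banach V -> banach (blin_NormedModule U V).
Proof.
intros hV F PF CF.
assert (FF := filter_filter (F := F)).
assert (Hb : forall (A B : blin U V) r u, ball A r B -> norm (minus (B u) (A u)) <= r * norm u).
{ intros A B r u H; change (opnorm (minus B A) < r) in H.
  apply Rle_trans with (opnorm (minus B A) * norm u).
  - exact (opnorm_bound (minus B A : blin U V) u (blin_lin _)).
  - apply Rmult_le_compat_r; [apply norm_ge_0|lra]. }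
assert (Hl : forall u : U, exists l : V,
  forall eps, 0 < eps -> F (fun A : blin U V => norm (minus (A u) l) < eps)).
{ intros u; apply (banach_filter_lim hV F PF (fun A : blin U V => A u)).
  intros eps He; assert (N := norm_ge_0 u).
  assert (E : 0 < eps / (norm u + 1)) by (apply Rdiv_lt_0_compat; lra).
  destruct (CF (mkposreal _ E)) as [A HA]; exists A; revert HA; apply filter_imp.
  intros B HB; apply Rle_lt_trans with (1 := Hb A B _ u HB); simpl.
  apply Rmult_lt_reg_r with (norm u + 1); [lra|].
  replace (eps / (norm u + 1) * norm u * (norm u + 1)) with (eps * norm u) by (field; lra); nra. }
set (L := fun u => epsilon (inhabits (zero : V))
  (fun l => forall eps, 0 < eps -> F (fun A : blin U V => norm (minus (A u) l) < eps))).
assert (HL : forall u eps, 0 < eps -> F (fun A : blin U V => norm (minus (A u) (L u)) < eps)).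
{ intros u; exact (epsilon_spec (inhabits (zero : V)) (fun l => forall eps, 0 < eps ->
    F (fun A : blin U V => norm (minus (A u) l) < eps)) (Hl u)). }
assert (Hlin : is_linear L).
{ split.
  - intros u v; apply norm_minus_eq_0, (le_plus_epsilon _ _ 3); [lra|]; intros eps He.
    destruct (filter_ex _ (filter_and _ _ (HL (plus u v) eps He)
      (filter_and _ _ (HL u eps He) (HL v eps He)))) as [A [H1 [H2 H3]]].
    rewrite (linear_plus _ (blin_lin A)) in H1.
    replace (minus (L (plus u v)) (plus (L u) (L v))) with
      (minus (plus (minus (A u) (L u)) (minus (A v) (L v)))
         (minus (plus (A u) (A v)) (L (plus u v)))) by (module V).
    apply Rle_trans with (1 := norm_minus_le _ _).
    replace (0 + 3 * eps) with (eps + eps + eps) by ring.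
    apply Rplus_le_compat; [|left; exact H1].
    apply Rle_trans with (1 := norm_triangle _ _).
    apply Rplus_le_compat; left; [exact H2|exact H3].
  - intros c u; apply norm_minus_eq_0, (le_plus_epsilon _ _ (1 + Cmod c)).
    { generalize (Cmod_ge_0 c); lra. }
    intros eps He.
    destruct (filter_ex _ (filter_and _ _ (HL (scal c u) eps He) (HL u eps He))) as [A [H1 H2]].
    rewrite (linear_scal _ (blin_lin A)) in H1.
    replace (minus (L (scal c u)) (scal c (L u))) with
      (minus (scal c (minus (A u) (L u))) (minus (scal c (A u)) (L (scal c u)))) by (module V).
    apply Rle_trans with (1 := norm_minus_le _ _); rewrite (norm_scal_C (V := V) c).
    replace (0 + (1 + Cmod c) * eps) with (Cmod c * eps + eps) by ring.
    apply Rplus_le_compat; [|left; exact H1].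
    apply Rmult_le_compat_l; [apply Cmod_ge_0|left; exact H2].
  - destruct (CF (mkposreal 1 Rlt_0_1)) as [A0 HA0].
    assert (N0 := opnorm_ge_0 A0 (blin_lin A0)).
    exists (opnorm A0 + 1); split; [lra|]; intros u.
    apply (le_plus_epsilon _ _ 1); [lra|]; intros eps He.
    destruct (filter_ex _ (filter_and _ _ HA0 (HL u eps He))) as [A [H1 H2]].
    apply Hb with (u := u) in H1; simpl in H1.
    assert (H3 := opnorm_bound A0 u (blin_lin A0)).
    assert (H4 := norm_le_plus (A u) (A0 u)).
    assert (H5 := norm_le_plus (L u) (A u)); rewrite norm_minus_sym in H5; lra. }
exists (Blin L Hlin); intros eps.
(* B and an auxiliary A both lie within eps/4 of A0, and A u is as close to L u as desired; this
   gives eps/2 in operator norm, hence the strict bound eps. *)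
assert (E : 0 < eps / 4) by (generalize (cond_pos eps); lra).
destruct (CF (mkposreal _ E)) as [A0 HA0].
generalize HA0; apply filter_imp; intros B HB.
change (opnorm (minus (B : blin_NormedModule U V) (Blin L Hlin)) < eps).
apply Rle_lt_trans with (eps / 2); [|generalize (cond_pos eps); lra].
apply opnorm_le; [apply blin_lin|generalize (cond_pos eps); lra|].
intros u; change (norm (minus (B u) (L u)) <= eps / 2 * norm u).
apply (le_plus_epsilon _ _ 1); [lra|]; intros eta He.
destruct (filter_ex _ (filter_and _ _ HA0 (HL u eta He))) as [A [H1 H2]].
apply Hb with (u := u) in H1; simpl in H1.
assert (H3 := Hb A0 B _ u HB); simpl in H3.
apply Rle_trans with (1 := norm_minus_triangle _ (A u) _).
assert (T := norm_minus_triangle (B u) (A0 u) (A u)).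
rewrite (norm_minus_sym (A0 u)) in T; lra.
Qed.

Lemma le_of_small (a b k delta : R) : 0 <= k -> 0 < delta ->
  (forall t, 0 < t < delta -> a <= b + k * t) -> a <= b.
Proof.
intros Hk Hd H; apply (le_plus_epsilon _ _ k); [easy|]; intros eps He.
assert (Hm : 0 < Rmin eps delta) by now apply Rmin_pos.
assert (h1 := Rmin_l eps delta); assert (h2 := Rmin_r eps delta).
specialize (H (Rmin eps delta / 2) ltac:(lra)); nra.
Qed.

(** The hypothesis makes q Cauchy as t decreases to 0, and letting s tend to 0 in it gives the rate
    k t. This rate holds on all of [dom], also beyond delta. *)
Lemma limit_at_0 {V : NormedModule C_AbsRing} (hV : banach V) (q : R -> V) (dom : R -> Prop)
    k delta : 0 <= k -> 0 < delta -> (forall t, 0 < t < delta -> dom t) ->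
  (forall t s, 0 < t -> 0 < s -> dom t -> dom s -> norm (minus (q t) (q s)) <= k * (t + s)) ->
  exists l, forall t, 0 < t -> dom t -> norm (minus (q t) l) <= k * t.
Proof.
intros Hk Hd Hdom H.
set (F := fun P : R -> Prop => exists d, 0 < d /\ forall t, 0 < t < d -> P t).
assert (PF : ProperFilter F).
{ split; [|split].
  - intros P [d [Hd' HP]]; exists (d / 2); apply HP; lra.
  - exists 1; split; [lra|easy].
  - intros P Q [d1 [Hd1 HP]] [d2 [Hd2 HQ]]; exists (Rmin d1 d2); split; [now apply Rmin_pos|].
    intros t Ht; generalize (Rmin_l d1 d2), (Rmin_r d1 d2); intros; split; [apply HP|apply HQ]; lra.
  - intros P Q HPQ [d [Hd' HP]]; exists d; split; [easy|]; intros t Ht; now apply HPQ, HP. }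
destruct (banach_filter_lim hV F PF q) as [l Hl].
- intros eps He.
  set (d := Rmin delta (eps / (2 * (k + 1)))).
  assert (Hd' : 0 < d) by (apply Rmin_pos; [easy|apply Rdiv_lt_0_compat; lra]).
  assert (h1 : d <= delta) by apply Rmin_l.
  assert (h2 : d <= eps / (2 * (k + 1))) by apply Rmin_r.
  exists (d / 2), d; split; [easy|]; intros t Ht.
  apply Rle_lt_trans with (1 := H t (d / 2) ltac:(lra) ltac:(lra) (Hdom t ltac:(lra))
    (Hdom (d / 2) ltac:(lra))).
  apply Rmult_le_compat_r with (r := 2 * (k + 1)) in h2; [|lra].
  replace (eps / (2 * (k + 1)) * (2 * (k + 1))) with eps in h2 by (field; lra).
  nra.
- exists l; intros t Ht Hdt.
  apply (le_plus_epsilon _ _ (k + 1)); [lra|]; intros eps He.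
  destruct (Hl eps He) as [d [Hd' HH]].
  set (s := Rmin (Rmin d delta) eps / 2).
  assert (Hm : 0 < Rmin (Rmin d delta) eps) by (repeat apply Rmin_pos; easy).
  assert (h1 := Rmin_l (Rmin d delta) eps); assert (h2 := Rmin_r (Rmin d delta) eps).
  assert (h3 := Rmin_l d delta); assert (h4 := Rmin_r d delta).
  assert (Hs : 0 < s) by (unfold s; lra).
  specialize (HH s ltac:(unfold s; lra)).
  specialize (H t s Ht Hs Hdt (Hdom s ltac:(unfold s; lra))).
  apply Rle_trans with (1 := norm_minus_triangle _ (q s) _).
  assert (s <= eps) by (unfold s; lra); nra.
Qed.

(** B v is the limit of f(tv)/t as t decreases to 0. The defects of f at arguments scaled by t are
    of order t^2, so after division by t they vanish in the limit and B is linear. *)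
Lemma approximately_linear {U V : NormedModule C_AbsRing} (hV : banach V) (f : U -> V) r k :
  0 < r -> 0 <= k ->
  (forall v w, norm v <= r -> norm w <= r ->
     norm (minus (minus (f (plus v w)) (f v)) (f w)) <= k * norm v * norm w) ->
  (forall (c : C) v, norm v <= r -> norm (scal (c : C_AbsRing) v) <= r ->
     norm (minus (f (scal (c : C_AbsRing) v)) (scal (c : C_AbsRing) (f v)))
       <= k * (Cmod c ^ 2 + Cmod c) * norm v ^ 2) ->
  (forall v, norm v <= r -> norm (f v) <= k * norm v) ->
  exists B, is_linear B /\ forall v, norm v <= r -> norm (minus (f v) (B v)) <= k * norm v ^ 2.
Proof.
intros Hr Hk Hadd Hhom Hbd.
set (q := fun (v : U) (t : R) =>
  scal (RtoC (/ t) : C_AbsRing) (f (scal (RtoC t : C_AbsRing) v)) : V).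
assert (Hsm : forall v : U, exists delta, 0 < delta /\
  forall t, 0 < t < delta -> t * norm v <= r).
{ intros v; assert (N := norm_ge_0 v); exists (r / (norm v + 1)).
  split; [apply Rdiv_lt_0_compat; lra|]; intros t [Ht1 Ht2].
  apply Rmult_lt_compat_r with (r := norm v + 1) in Ht2; [|lra].
  replace (r / (norm v + 1) * (norm v + 1)) with r in Ht2 by (field; lra); nra. }
assert (Hnt : forall t (v : U), 0 < t -> norm (scal (RtoC t : C_AbsRing) v) = t * norm v).
{ intros t v Ht; rewrite norm_scal_RtoC, Rabs_pos_eq; lra. }
assert (Hex : forall v, exists l, forall t, 0 < t -> t * norm v <= r ->
  norm (minus (q v t) l) <= k * norm v ^ 2 * t).
{ intros v; destruct (Hsm v) as [d [Hd Hd']].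
  apply (limit_at_0 hV (q v) (fun t => t * norm v <= r) (k * norm v ^ 2) d); try easy.
  { apply Rmult_le_pos; [easy|apply pow2_ge_0]. }
  intros t s Ht Hs Htv Hsv.
  specialize (Hhom (RtoC (t / s)) (scal (RtoC s : C_AbsRing) v)).
  rewrite Hnt in Hhom by easy.
  replace (scal (RtoC (t / s) : C_AbsRing) (scal (RtoC s : C_AbsRing) v))
    with (scal (RtoC t : C_AbsRing) v) in Hhom
    by (module_eq U; apply injective_projections; simpl; field; lra).
  rewrite Hnt in Hhom by easy; specialize (Hhom Hsv Htv).
  assert (Hts : 0 < t / s) by now apply Rdiv_lt_0_compat.
  rewrite Cmod_R, Rabs_pos_eq in Hhom by lra.
  (* Homogeneity with c = t/s at the vector sv: the factor (|c|^2 + |c|) s^2 / t is exactly t + s,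
     the Cauchy bound of [limit_at_0]. *)
  replace (minus (q v t) (q v s)) with (scal (RtoC (/ t) : C_AbsRing)
    (minus (f (scal (RtoC t : C_AbsRing) v))
       (scal (RtoC (t / s) : C_AbsRing) (f (scal (RtoC s : C_AbsRing) v))))).
  2:{ unfold q; module_eq V; apply injective_projections; simpl; field; lra. }
  rewrite norm_scal_RtoC, Rabs_pos_eq by (left; now apply Rinv_0_lt_compat).
  apply Rle_trans with (/ t * (k * ((t / s) ^ 2 + t / s) * (s * norm v) ^ 2)).
  - apply Rmult_le_compat_l; [left; now apply Rinv_0_lt_compat|easy].
  - right; field; lra. }
set (B := fun v => epsilon (inhabits (zero : V)) (fun l => forall t, 0 < t -> t * norm v <= r ->
  norm (minus (q v t) l) <= k * norm v ^ 2 * t)).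
assert (HB : forall v t, 0 < t -> t * norm v <= r ->
  norm (minus (q v t) (B v)) <= k * norm v ^ 2 * t).
{ intros v; exact (epsilon_spec (inhabits (zero : V)) (fun l => forall t, 0 < t ->
    t * norm v <= r -> norm (minus (q v t) l) <= k * norm v ^ 2 * t) (Hex v)). }
assert (Hpos : forall v : U, 0 <= k * norm v ^ 2)
  by (intros v; apply Rmult_le_pos; [easy|apply pow2_ge_0]).
exists B; split; [split|].
- intros v w; apply norm_minus_eq_0.
  destruct (Hsm v) as [d1 [Hd1 H1]], (Hsm w) as [d2 [Hd2 H2]], (Hsm (plus v w)) as [d3 [Hd3 H3]].
  assert (N1 := norm_ge_0 v); assert (N2 := norm_ge_0 w).
  apply (le_of_small _ _ (k * norm v * norm w + k * norm v ^ 2 + k * norm w ^ 2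
    + k * norm (plus v w) ^ 2) (Rmin (Rmin d1 d2) d3)).
  + assert (0 <= k * norm v * norm w) by (repeat apply Rmult_le_pos; easy).
    generalize (Hpos v), (Hpos w), (Hpos (plus v w)); lra.
  + repeat apply Rmin_pos; easy.
  + intros t Ht.
    assert (h1 := Rmin_l (Rmin d1 d2) d3); assert (h2 := Rmin_r (Rmin d1 d2) d3).
    assert (h3 := Rmin_l d1 d2); assert (h4 := Rmin_r d1 d2).
    specialize (H1 t ltac:(lra)); specialize (H2 t ltac:(lra)); specialize (H3 t ltac:(lra)).
    assert (E1 := HB v t (proj1 Ht) H1); assert (E2 := HB w t (proj1 Ht) H2).
    assert (E3 := HB (plus v w) t (proj1 Ht) H3).
    specialize (Hadd (scal (RtoC t : C_AbsRing) v) (scal (RtoC t : C_AbsRing) w)).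
    rewrite !Hnt in Hadd by easy; specialize (Hadd H1 H2).
    replace (minus (B (plus v w)) (plus (B v) (B w))) with
      (plus (minus (plus (minus (q v t) (B v)) (minus (q w t) (B w)))
                 (minus (q (plus v w) t) (B (plus v w))))
        (scal (RtoC (/ t) : C_AbsRing) (minus (minus (f (plus (scal (RtoC t : C_AbsRing) v)
           (scal (RtoC t : C_AbsRing) w))) (f (scal (RtoC t : C_AbsRing) v)))
           (f (scal (RtoC t : C_AbsRing) w))))).
    2:{ unfold q.
        replace (plus (scal (RtoC t : C_AbsRing) v) (scal (RtoC t : C_AbsRing) w))
          with (scal (RtoC t : C_AbsRing) (plus v w)) by (module U).
        module V. }
    apply Rle_trans with (1 := norm_triangle _ _).
    rewrite norm_scal_RtoC, Rabs_pos_eq by (left; now apply Rinv_0_lt_compat).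
    apply Rmult_le_compat_l with (r := / t) in Hadd; [|left; now apply Rinv_0_lt_compat].
    replace (/ t * (k * (t * norm v) * (t * norm w))) with (k * norm v * norm w * t) in Hadd
      by (field; lra).
    apply Rle_trans with (((k * norm v ^ 2 * t + k * norm w ^ 2 * t) + k * norm (plus v w) ^ 2 * t)
      + k * norm v * norm w * t); [|right; ring].
    apply Rplus_le_compat; [|exact Hadd].
    apply Rle_trans with (1 := norm_minus_le _ _); apply Rplus_le_compat; [|exact E3].
    apply Rle_trans with (1 := norm_triangle _ _); now apply Rplus_le_compat.
- intros c v; apply norm_minus_eq_0.
  destruct (Hsm v) as [d1 [Hd1 H1]], (Hsm (scal c v)) as [d2 [Hd2 H2]].
  assert (N := Cmod_ge_0 c).
  apply (le_of_small _ _ (k * (Cmod c ^ 2 + Cmod c) * norm v ^ 2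
    + k * norm (scal c v) ^ 2 + Cmod c * (k * norm v ^ 2)) (Rmin d1 d2)).
  + assert (0 <= k * (Cmod c ^ 2 + Cmod c) * norm v ^ 2).
    { apply Rmult_le_pos; [apply Rmult_le_pos; [easy|]|apply pow2_ge_0].
      generalize (pow2_ge_0 (Cmod c)); lra. }
    assert (0 <= Cmod c * (k * norm v ^ 2)) by now apply Rmult_le_pos.
    generalize (Hpos (scal c v)); lra.
  + now apply Rmin_pos.
  + intros t Ht.
    assert (h1 := Rmin_l d1 d2); assert (h2 := Rmin_r d1 d2).
    specialize (H1 t ltac:(lra)); specialize (H2 t ltac:(lra)).
    assert (E1 := HB v t (proj1 Ht) H1); assert (E2 := HB (scal c v) t (proj1 Ht) H2).
    specialize (Hhom c (scal (RtoC t : C_AbsRing) v)).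
    replace (scal (c : C_AbsRing) (scal (RtoC t : C_AbsRing) v))
      with (scal (RtoC t : C_AbsRing) (scal c v)) in Hhom by (module U).
    rewrite !Hnt in Hhom by easy; specialize (Hhom H1 H2).
    replace (minus (B (scal c v)) (scal c (B v))) with
      (plus (minus (scal c (minus (q v t) (B v))) (minus (q (scal c v) t) (B (scal c v))))
       (scal (RtoC (/ t) : C_AbsRing) (minus (f (scal (RtoC t : C_AbsRing) (scal c v)))
          (scal (c : C_AbsRing) (f (scal (RtoC t : C_AbsRing) v)))))).
    2:{ unfold q; module V. }
    apply Rle_trans with (1 := norm_triangle _ _).
    rewrite norm_scal_RtoC, Rabs_pos_eq by (left; now apply Rinv_0_lt_compat).
    apply Rmult_le_compat_l with (r := / t) in Hhom; [|left; now apply Rinv_0_lt_compat].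
    replace (/ t * (k * (Cmod c ^ 2 + Cmod c) * (t * norm v) ^ 2))
      with (k * (Cmod c ^ 2 + Cmod c) * norm v ^ 2 * t) in Hhom by (field; lra).
    apply Rle_trans with ((Cmod c * (k * norm v ^ 2 * t) + k * norm (scal c v) ^ 2 * t)
      + k * (Cmod c ^ 2 + Cmod c) * norm v ^ 2 * t); [|right; ring].
    apply Rplus_le_compat; [|exact Hhom].
    apply Rle_trans with (1 := norm_minus_le _ _); apply Rplus_le_compat; [|exact E2].
    rewrite (norm_scal_C (V := V) c); now apply Rmult_le_compat_l.
- exists (k + 1); split; [lra|]; intros v; assert (N := norm_ge_0 v).
  apply Rle_trans with (k * norm v); [|nra].
  destruct (Hsm v) as [d1 [Hd1 H1]].
  apply (le_of_small _ _ (k * norm v ^ 2) d1); [apply Hpos|easy|].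
  intros t Ht; specialize (H1 t Ht).
  assert (E1 := HB v t (proj1 Ht) H1).
  specialize (Hbd (scal (RtoC t : C_AbsRing) v)); rewrite Hnt in Hbd by easy.
  specialize (Hbd H1).
  assert (T := norm_le_plus (B v) (q v t)); rewrite norm_minus_sym in T.
  assert (Q : norm (q v t) <= k * norm v); [|lra].
  unfold q; rewrite norm_scal_RtoC, Rabs_pos_eq by (left; now apply Rinv_0_lt_compat).
  apply Rmult_le_reg_l with t; [easy|].
  rewrite <- Rmult_assoc, Rinv_r by lra; lra.
(* The rate of convergence at t = 1, admissible because |v| <= r, is the quadratic error bound. *)
- intros v Hv; assert (E := HB v 1 Rlt_0_1 ltac:(lra)).
  replace (q v 1) with (f v) in E; [lra|].
  unfold q; rewrite Rinv_1.
  replace (scal (RtoC 1 : C_AbsRing) v) with v by (module U); module V.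
Qed.

Definition hol {U V : NormedModule C_AbsRing} (F : U -> V) (x : U) : Prop :=
  exists L, is_linear L /\ fder F x L.

Lemma hol_filterdiff {U V : NormedModule C_AbsRing} (F : U -> V) x :
  hol F x <-> ex_filterdiff F (locally x).
Proof. split; intros [L H]; exists L; now apply filterdiff_fder. Qed.

Lemma fder_D {U V : NormedModule C_AbsRing} (F : U -> V) x : hol F x -> fder F x (D F x).
Proof.
intros [L [hL HL]].
apply (filterdiff_fder F x (D F x)).
apply (epsilon_spec (inhabits (zero : blin U V)) (fun L => filterdiff F (locally x) L)).
exists (Blin L hL); now apply filterdiff_fder.
Qed.

Lemma fder_shift {U V : NormedModule C_AbsRing} (F : U -> V) (y w : U) L :
  fder F (plus y w) L -> fder (fun z => F (plus z w)) y L.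
Proof.
intros H eps He; destruct (H eps He) as [d [Hd HH]]; exists d; split; [easy|].
intros u Hu; replace (plus (plus y u) w) with (plus (plus y w) u) by (module U).
now apply HH.
Qed.

Lemma is_linear_fun_minus {U V : NormedModule C_AbsRing} (L M : U -> V) :
  is_linear L -> is_linear M -> is_linear (fun u => minus (L u) (M u)).
Proof. intros hL hM; apply is_linear_fun_plus; [easy|now apply is_linear_fun_opp]. Qed.

(** * Lipschitz and second-order estimates for the derivative *)

Section Regularity.
Variables (U V : NormedModule C_AbsRing) (hV : banach V) (F : U -> V) (x : U) (rho M : R).
Hypothesis rho_pos : 0 < rho.
(** The margin 4 rho is spent one rho at a time: DF is bounded up to distance 3 rho, F is Lipschitz
    from points up to 2 rho, and DF from points up to rho. *)
Hypothesis F_hol : forall y : U, norm (minus y x) <= 4 * rho -> hol F y.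
Hypothesis F_bound : forall y : U, norm (minus y x) <= 4 * rho -> norm (F y) <= M.

Lemma norm_shift (y u : U) : norm (minus (plus y u) x) <= norm (minus y x) + norm u.
Proof.
replace (minus (plus y u) x) with (plus (minus y x) u) by (module U); apply norm_triangle.
Qed.

Lemma M_pos : 0 <= M.
Proof.
apply Rle_trans with (1 := norm_ge_0 (F x)), F_bound.
replace (minus x x) with (@zero (NormedModule.AbelianMonoid _ U)) by (module U).
rewrite norm_zero; lra.
Qed.

(** Cauchy's estimate with radius rho, iterated: [K1] bounds DF and is a Lipschitz constant of F,
    [K2] is a Lipschitz constant of DF. *)
Let K1 := 2 * M / rho.
Let K2 := 2 * K1 / rho.

Lemma K1_pos : 0 <= K1.
Proof. apply Rdiv_le_0_compat; [generalize M_pos; lra|easy]. Qed.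

Lemma K2_pos : 0 <= K2.
Proof. apply Rdiv_le_0_compat; [generalize K1_pos; lra|easy]. Qed.

Lemma D_bound (y v : U) : norm (minus y x) <= 3 * rho -> norm (D F y v) <= K1 * norm v.
Proof.
intros Hy; apply (cauchy_estimate hV F y rho M (D F y)); try easy.
- intros u Hu; exists (D F (plus y u)); split; [apply blin_lin|].
  apply fder_D, F_hol, Rle_trans with (1 := norm_shift _ _); lra.
- intros u Hu; apply F_bound, Rle_trans with (1 := norm_shift _ _); lra.
- apply blin_lin.
- apply fder_D, F_hol; lra.
Qed.

Lemma norm_scal_01 (t : R) (w : U) : 0 <= t <= 1 -> norm (scal (RtoC t : C_AbsRing) w) <= norm w.
Proof.
intros Ht; rewrite norm_scal_RtoC, Rabs_pos_eq by lra; generalize (norm_ge_0 w); nra.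
Qed.

Lemma norm_shift_01 (t : R) (y w : U) : 0 <= t <= 1 ->
  norm (minus (plus y (scal (RtoC t : C_AbsRing) w)) x) <= norm (minus y x) + norm w.
Proof.
intros Ht; apply Rle_trans with (1 := norm_shift _ _).
apply Rplus_le_compat_l; now apply norm_scal_01.
Qed.

Lemma F_lipschitz (y w : U) : norm (minus y x) <= 2 * rho -> norm w <= rho ->
  norm (minus (F (plus y w)) (F y)) <= K1 * norm w.
Proof.
intros Hy Hw; apply mean_value with (L := fun t => D F (plus y (scal (RtoC t : C_AbsRing) w))).
- apply Rmult_le_pos; [apply K1_pos|apply norm_ge_0].
- intros t Ht; assert (Hn := norm_shift_01 t y w Ht).
  assert (Hs := norm_scal_01 t w Ht); split; [apply blin_lin|split].
  + apply fder_D, F_hol, (Rle_trans _ _ _ Hn); lra.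
  + apply D_bound, (Rle_trans _ _ _ Hn); lra.
Qed.

Lemma fder_difference (y w : U) : norm (minus y x) <= 2 * rho -> norm w <= 2 * rho ->
  fder (fun z => minus (F (plus z w)) (F z)) y (fun v => minus (D F (plus y w) v) (D F y v)).
Proof.
intros Hy Hw; apply fder_minus; [apply fder_shift|]; apply fder_D, F_hol; [|lra].
apply Rle_trans with (1 := norm_shift _ _); lra.
Qed.

Lemma D_lipschitz (y w v : U) : norm (minus y x) <= rho -> norm w <= rho ->
  norm (minus (D F (plus y w) v) (D F y v)) <= K2 * norm w * norm v.
Proof.
intros Hy Hw.
replace (K2 * norm w) with (2 * (K1 * norm w) / rho) by (unfold K2; field; lra).
apply (cauchy_estimate hV (fun z => minus (F (plus z w)) (F z)) y rho (K1 * norm w)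
  (fun v => minus (D F (plus y w) v) (D F y v))); try easy.
- intros u Hu; exists (fun v => minus (D F (plus (plus y u) w) v) (D F (plus y u) v)).
  split; [apply is_linear_fun_minus; apply blin_lin|].
  apply fder_difference; [apply Rle_trans with (1 := norm_shift _ _)|]; lra.
- intros u Hu; apply F_lipschitz; [apply Rle_trans with (1 := norm_shift _ _); lra|easy].
- apply is_linear_fun_minus; apply blin_lin.
- apply fder_difference; lra.
Qed.

(** Mean value inequality for z -> F(z) - DF(y) z, whose derivative along the segment is DF(y + tw)
    - DF(y), at most K2 |w|. *)
Lemma taylor (y w : U) : norm (minus y x) <= rho -> norm w <= rho ->
  norm (minus (minus (F (plus y w)) (F y)) (D F y w)) <= K2 * norm w ^ 2.
Proof.
intros Hy Hw.
replace (minus (minus (F (plus y w)) (F y)) (D F y w)) with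
  (minus (minus (F (plus y w)) (D F y (plus y w))) (minus (F y) (D F y y)))
  by (rewrite (linear_plus _ (blin_lin (D F y))); module V).
apply (mean_value (fun z => minus (F z) (D F y z)) y w
  (fun t v => minus (D F (plus y (scal (RtoC t : C_AbsRing) w)) v) (D F y v))).
- apply Rmult_le_pos; [apply K2_pos|apply pow2_ge_0].
- intros t Ht; assert (Hn := norm_shift_01 t y w Ht).
  assert (Hs := norm_scal_01 t w Ht); split; [apply is_linear_fun_minus; apply blin_lin|split].
  + apply fder_minus; [apply fder_D, F_hol, (Rle_trans _ _ _ Hn); lra|apply fder_linear, blin_lin].
  + apply Rle_trans with (1 := D_lipschitz y _ w Hy (Rle_trans _ _ _ Hs Hw)).
    assert (N := norm_ge_0 w); assert (N2 := K2_pos).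
    apply Rle_trans with (K2 * norm w * norm w); [|lra].
    apply Rmult_le_compat_r; [easy|]; now apply Rmult_le_compat_l.
Qed.

(** Mean value inequality in the direction v for z -> F(z + w) - F(z), whose derivative is at most
    K2 |w|. The halves keep y + tv within rho of x. *)
Lemma second_difference (y v w : U) : norm (minus y x) <= rho / 2 -> norm v <= rho / 2 ->
  norm w <= rho / 2 ->
  norm (minus (minus (F (plus (plus y v) w)) (F (plus y v))) (minus (F (plus y w)) (F y)))
    <= K2 * norm v * norm w.
Proof.
intros Hy Hv Hw.
apply (mean_value (fun z => minus (F (plus z w)) (F z)) y v
  (fun t u => minus (D F (plus (plus y (scal (RtoC t : C_AbsRing) v)) w) u)
    (D F (plus y (scal (RtoC t : C_AbsRing) v)) u))).
- apply Rmult_le_pos; [apply Rmult_le_pos; [apply K2_pos|]|]; apply norm_ge_0.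
- intros t Ht; assert (Hn := norm_shift_01 t y v Ht).
  assert (Hs := norm_scal_01 t v Ht); split; [apply is_linear_fun_minus; apply blin_lin|split].
  + apply fder_difference; [apply (Rle_trans _ _ _ Hn); lra|lra].
  + replace (K2 * norm v * norm w) with (K2 * norm w * norm v) by ring.
    apply D_lipschitz; [apply (Rle_trans _ _ _ Hn)|]; lra.
Qed.

Let f (w : U) : blin_NormedModule U V := minus (D F (plus x w) : blin_NormedModule U V) (D F x).

(** This is 2 K2 / (rho / 2): the second-order differences are controlled at distance rho/2 from x,
    so Cauchy's estimate is used with that radius. *)
Let K3 := 4 * K2 / rho.

Lemma K3_pos : 0 <= K3.
Proof. apply Rdiv_le_0_compat; [generalize K2_pos; lra|easy]. Qed.

Lemma norm_minus_diag : norm (minus x x) = 0.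
Proof.
replace (minus x x) with (@zero (NormedModule.AbelianMonoid _ U)) by (module U).
apply norm_zero.
Qed.

Lemma D_additive (v w : U) : norm v <= rho / 2 -> norm w <= rho / 2 ->
  norm (minus (minus (f (plus v w)) (f v)) (f w)) <= K3 * norm v * norm w.
Proof.
intros Hv Hw.
assert (Nv := norm_ge_0 v); assert (Nw := norm_ge_0 w); assert (N0 := norm_minus_diag).
apply opnorm_le; [apply blin_lin|apply Rmult_le_pos; [apply Rmult_le_pos; [apply K3_pos|]|]; easy|].
intros u.
change (norm (minus (minus (minus (D F (plus x (plus v w)) u) (D F x u))
  (minus (D F (plus x v) u) (D F x u))) (minus (D F (plus x w) u) (D F x u)))
  <= K3 * norm v * norm w * norm u).
rewrite plus_assoc.
match goal with |- norm ?a <= _ => replace a with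
  (minus (minus (D F (plus (plus x v) w) u) (D F (plus x v) u))
    (minus (D F (plus x w) u) (D F x u))) by (module V) end.
replace (K3 * norm v * norm w) with (2 * (K2 * norm v * norm w) / (rho / 2))
  by (unfold K3; field; lra).
assert (Hd : forall y : U, norm (minus y x) <= rho / 2 ->
  fder (fun z => minus (minus (F (plus (plus z v) w)) (F (plus z v)))
    (minus (F (plus z w)) (F z))) y
   (fun u => minus (minus (D F (plus (plus y v) w) u) (D F (plus y v) u))
    (minus (D F (plus y w) u) (D F y u)))).
{ intros y Hy; apply fder_minus.
  - apply (fder_shift (fun z => minus (F (plus z w)) (F z))).
    apply fder_difference; [apply Rle_trans with (1 := norm_shift _ _)|]; lra.
  - apply fder_difference; lra. }
apply (cauchy_estimate hV (fun z => minus (minus (F (plus (plus z v) w)) (F (plus z v)))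
    (minus (F (plus z w)) (F z))) x (rho / 2) (K2 * norm v * norm w)
  (fun u => minus (minus (D F (plus (plus x v) w) u) (D F (plus x v) u))
    (minus (D F (plus x w) u) (D F x u)))).
- lra.
- intros z Hz; eexists; split; [|apply Hd; apply Rle_trans with (1 := norm_shift _ _); lra].
  apply is_linear_fun_minus; apply is_linear_fun_minus; apply blin_lin.
- intros z Hz; apply second_difference; try easy; apply Rle_trans with (1 := norm_shift _ _); lra.
- apply is_linear_fun_minus; apply is_linear_fun_minus; apply blin_lin.
- apply Hd; lra.
Qed.

Lemma D_homogeneous (c : C) (v : U) : norm v <= rho / 2 -> norm (scal (c : C_AbsRing) v) <= rho / 2 ->
  norm (minus (f (scal (c : C_AbsRing) v)) (scal (c : C_AbsRing) (f v)))
    <= K3 * (Cmod c ^ 2 + Cmod c) * norm v ^ 2.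
Proof.
intros Hv Hcv.
assert (Nv := norm_ge_0 v); assert (Nc := Cmod_ge_0 c); assert (N0 := norm_minus_diag).
assert (Nq : 0 <= (Cmod c ^ 2 + Cmod c) * norm v ^ 2).
{ apply Rmult_le_pos; [generalize (pow2_ge_0 (Cmod c)); lra|apply pow2_ge_0]. }
apply opnorm_le; [apply blin_lin|rewrite Rmult_assoc; apply Rmult_le_pos; [apply K3_pos|easy]|].
intros u; set (cv := scal (c : C_AbsRing) v) in *.
change (norm (minus (minus (D F (plus x cv) u) (D F x u))
  (scal (c : C_AbsRing) (minus (D F (plus x v) u) (D F x u))))
  <= K3 * (Cmod c ^ 2 + Cmod c) * norm v ^ 2 * norm u).
replace (K3 * (Cmod c ^ 2 + Cmod c) * norm v ^ 2) with
  (2 * (K2 * ((Cmod c ^ 2 + Cmod c) * norm v ^ 2)) / (rho / 2)) by (unfold K3; field; lra).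
assert (Hd : forall y : U, norm (minus y x) <= rho ->
  fder (fun z => minus (minus (F (plus z cv)) (F z))
    (scal (c : C_AbsRing) (minus (F (plus z v)) (F z)))) y
   (fun u => minus (minus (D F (plus y cv) u) (D F y u))
    (scal (c : C_AbsRing) (minus (D F (plus y v) u) (D F y u))))).
{ intros y Hy; apply fder_minus; [|apply (fder_scal c)]; apply fder_difference; lra. }
assert (Hlin : forall y, is_linear (fun u => minus (minus (D F (plus y cv) u) (D F y u))
    (scal (c : C_AbsRing) (minus (D F (plus y v) u) (D F y u))))).
{ intros y; apply is_linear_fun_minus; [|apply is_linear_fun_scal]; apply is_linear_fun_minus; apply blin_lin. }
apply (cauchy_estimate hV (fun z => minus (minus (F (plus z cv)) (F z))
    (scal (c : C_AbsRing) (minus (F (plus z v)) (F z)))) x (rho / 2)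
    (K2 * ((Cmod c ^ 2 + Cmod c) * norm v ^ 2))
  (fun u => minus (minus (D F (plus x cv) u) (D F x u))
    (scal (c : C_AbsRing) (minus (D F (plus x v) u) (D F x u))))).
- lra.
- intros z Hz; eexists; split; [|apply Hd; apply Rle_trans with (1 := norm_shift _ _); lra]; apply Hlin.
- intros z Hz; assert (Hxz : norm (minus (plus x z) x) <= rho) by (apply Rle_trans with (1 := norm_shift _ _); lra).
  assert (T1 := taylor (plus x z) cv Hxz ltac:(lra)).
  assert (T2 := taylor (plus x z) v Hxz ltac:(lra)).
  (* The linear terms DF(y)(cv) and c DF(y) v of the two Taylor expansions cancel; the remainders
     add up to K2 (|c|^2 + |c|) |v|^2. *)
  match type of T1 with norm ?a <= _ => match type of T2 with norm ?b <= _ =>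
    match goal with |- norm ?d <= _ =>
    replace d with (minus a (scal (c : C_AbsRing) b)) end end end.
  2:{ unfold cv at 2; rewrite (linear_scal _ (blin_lin (D F (plus x z)))); module V. }
  apply Rle_trans with (1 := norm_minus_le _ _); rewrite norm_scal_C.
  apply Rmult_le_compat_l with (1 := Nc) in T2.
  unfold cv in T1 at 3; rewrite norm_scal_C in T1.
  eapply Rle_trans; [apply Rplus_le_compat; [exact T1|exact T2]|right; ring].
- apply Hlin.
- apply Hd; lra.
Qed.

Lemma D_hol : hol (D F : U -> blin_NormedModule U V) x.
Proof.
assert (N0 := norm_minus_diag).
assert (NK2 := K2_pos); assert (NK3 := K3_pos).
(* One constant must serve three estimates: K3 for additivity and homogeneity, K2 for
   boundedness. *)
destruct (approximately_linear (banach_blin U V hV) f (rho / 2) (K2 + K3)) as [B [hB HB]].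
- lra.
- lra.
- intros v w Hv Hw; apply Rle_trans with (1 := D_additive v w Hv Hw).
  repeat (apply Rmult_le_compat_r; [apply norm_ge_0|]); lra.
- intros c v Hv Hcv; apply Rle_trans with (1 := D_homogeneous c v Hv Hcv).
  apply Rmult_le_compat_r; [apply pow2_ge_0|].
  apply Rmult_le_compat_r; [|lra].
  generalize (pow2_ge_0 (Cmod c)), (Cmod_ge_0 c); lra.
- intros v Hv; apply Rle_trans with (K2 * norm v).
  2:{ apply Rmult_le_compat_r; [apply norm_ge_0|lra]. }
  apply opnorm_le; [apply blin_lin|apply Rmult_le_pos; [easy|apply norm_ge_0]|].
  intros u; apply D_lipschitz; lra.
- exists B; split; [easy|].
  apply fder_suffices with (K2 + K3); [lra|]; intros eps He.
  exists (Rmin eps (rho / 2)); split; [apply Rmin_pos; lra|]; intros u Hu.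
  assert (h1 := Rlt_le_trans _ _ _ Hu (Rmin_l _ _)).
  assert (h2 := Rlt_le_trans _ _ _ Hu (Rmin_r _ _)).
  apply Rle_trans with (1 := HB u ltac:(lra)); assert (N := norm_ge_0 u).
  replace ((K2 + K3) * norm u ^ 2) with ((K2 + K3) * norm u * norm u) by ring.
  apply Rmult_le_compat_r; [easy|]; apply Rmult_le_compat_l; lra.
Qed.

End Regularity.

(** The bound M required by the section comes for free: differentiability at x alone makes F bounded
    near x. *)
Lemma hol_D {U V : NormedModule C_AbsRing} (hV : banach V) (F : U -> V) x :
  (exists r, 0 < r /\ forall y : U, norm (minus y x) < r -> hol F y) ->
  hol (D F : U -> blin_NormedModule U V) x.
Proof.
intros [r [Hr HF]].
assert (Hx : hol F x).
{ apply HF; replace (minus x x) with (@zero (NormedModule.AbelianMonoid _ U)) by (module U).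
  now rewrite norm_zero. }
destruct (fder_lipschitz F x _ (fder_D F x Hx) (linear_norm _ (blin_lin (D F x))))
  as [A [d [HA [Hd HL]]]].
assert (Hm : 0 < Rmin r d) by now apply Rmin_pos.
assert (h1 := Rmin_l r d); assert (h2 := Rmin_r r d).
(* With a fifth, the closed ball of radius 4 rho lies inside the open balls of radii r and d. *)
apply (D_hol U V hV F x (Rmin r d / 5) (norm (F x) + A * d)).
- lra.
- intros y Hy; apply HF; lra.
- intros y Hy; specialize (HL (minus y x) ltac:(lra)); rewrite plus_minus in HL.
  apply Rle_trans with (1 := norm_le_plus _ (F x)); nra.
Qed.

(** * Higher derivatives *)

(** A single head symbol for evaluation; elements of [Lk X (S k)] are accepted by conversion, so
    iterated evaluations stay uniform for rewriting. *)
Definition app {U V : NormedModule C_AbsRing} (A : blin_NormedModule U V) (u : U) : V :=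
  (A : blin U V) u.

Definition der {U V : NormedModule C_AbsRing} (F : U -> V) (x : U) (L : U -> V) : Prop :=
  is_linear L /\ fder F x L.

Lemma der_unique {U V : NormedModule C_AbsRing} (F : U -> V) x L M :
  der F x L -> der F x M -> forall u, L u = M u.
Proof. intros [h1 H1] [h2 H2]; now apply fder_unique with F x. Qed.

Lemma der_plus {U V : NormedModule C_AbsRing} (F G : U -> V) x L M :
  der F x L -> der G x M -> der (fun y => plus (F y) (G y)) x (fun u => plus (L u) (M u)).
Proof.
intros [h1 H1] [h2 H2]; split; [now apply is_linear_fun_plus|now apply fder_plus].
Qed.

Lemma der_const {U V : NormedModule C_AbsRing} (v : V) (x : U) :
  der (fun _ => v) x (fun _ => zero).
Proof. split; [apply is_linear_zero|apply fder_const]. Qed.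

Lemma der_comp {U V W : NormedModule C_AbsRing} (F : U -> V) (G : V -> W) x L M :
  der F x L -> der G (F x) M -> der (fun y => G (F y)) x (fun u => M (L u)).
Proof.
intros [h1 H1] [h2 H2]; split; [now apply is_linear_comp|].
apply fder_comp; try easy; apply (linear_norm _ h1).
Qed.

Lemma der_ext_loc {U V : NormedModule C_AbsRing} (F G : U -> V) x L r : 0 < r ->
  (forall u, norm u < r -> F (plus x u) = G (plus x u)) -> der F x L -> der G x L.
Proof. intros Hr E [h H]; split; [easy|now apply (fder_ext_loc F G x L r)]. Qed.

Lemma der_D {U V : NormedModule C_AbsRing} (F : U -> V) x : hol F x -> der F x (D F x).
Proof. intros H; split; [apply blin_lin|now apply fder_D]. Qed.

Lemma app_bound {U V : NormedModule C_AbsRing} (A : blin_NormedModule U V) (u : U) :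
  norm (app A u) <= norm A * norm u.
Proof. exact (opnorm_bound (A : blin U V) u (blin_lin (A : blin U V))). Qed.

Lemma linear_app_l {T U V : NormedModule C_AbsRing} (A : T -> blin_NormedModule U V) (u : U) :
  is_linear A -> is_linear (fun t => app (A t) u).
Proof.
intros hA; split.
- intros x y; rewrite (linear_plus _ hA); easy.
- intros k x; rewrite (linear_scal _ hA); easy.
- destruct (linear_norm _ hA) as [M [HM H]]; assert (N := norm_ge_0 u).
  exists (M * (norm u + 1)); split; [apply Rmult_lt_0_compat; lra|]; intros t.
  apply Rle_trans with (1 := app_bound _ _).
  assert (Nt := norm_ge_0 t); specialize (H t).
  apply Rle_trans with (M * norm t * norm u); [now apply Rmult_le_compat_r|].
  assert (0 <= M * norm t) by (apply Rmult_le_pos; lra); nra.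
Qed.

Lemma der_app {T U V : NormedModule C_AbsRing} (A : T -> blin_NormedModule U V) (b : T -> U)
    x A' b' : der A x A' -> der b x b' ->
  der (fun y => app (A y) (b y)) x (fun u => plus (app (A' u) (b x)) (app (A x) (b' u))).
Proof.
intros [hA HA] [hb Hb]; split.
- apply is_linear_fun_plus; [now apply linear_app_l|].
  apply (is_linear_comp b' (fun u => app (A x) u)); [easy|apply (blin_lin (A x : blin U V))].
- apply (fder_bilinear (fun (p : blin_NormedModule U V) q => app p q) 1); try easy.
  + lra.
  + intros p q q'; apply (linear_plus _ (blin_lin (p : blin U V))).
  + intros p q; rewrite Rmult_1_l; apply app_bound.
  + apply (linear_norm _ hA).
  + apply (linear_norm _ hb).
Qed.

Lemma der_app_const {T U V : NormedModule C_AbsRing} (A : T -> blin_NormedModule U V) (v : U)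
    x A' : der A x A' -> der (fun y => app (A y) v) x (fun u => app (A' u) v).
Proof.
intros HA; destruct (der_app A (fun _ => v) x A' _ HA (der_const v x)) as [h H]; split.
- apply linear_app_l, HA.
- refine (fder_eq _ _ _ _ _ H); intros u.
  assert (Z : app (A x) zero = zero)
    by apply (linear_zero _ (blin_lin (A x : blin U V))).
  etransitivity; [apply f_equal, Z|apply plus_zero_r].
Qed.

(** The second difference of F along v and w is symmetric in them, and equals B(w)v up to o((|v| +
    |w|)^2) by [Key]. Exchanging v and w and scaling both to 0 identifies B(w)v with B(v)w. *)
Lemma second_derivative_symmetric {U V : NormedModule C_AbsRing} (F : U -> V) (x : U) r
    (B : U -> blin_NormedModule U V) :
  0 < r -> (forall u, norm u < r -> hol F (plus x u)) ->
  der (D F : U -> blin_NormedModule U V) x B ->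
  forall v w, app (B v) w = app (B w) v.
Proof.
intros Hr HF [hB HB].
assert (Happ : forall A B : blin_NormedModule U V, forall u,
  app (minus A B) u = minus (app A u) (app B u)) by easy.
assert (Key : forall eps, 0 < eps -> exists delta, 0 < delta /\
  forall v w, norm v + norm w < delta ->
   norm (minus (minus (minus (F (plus (plus x v) w)) (F (plus x v)))
     (minus (F (plus x w)) (F x))) (app (B w) v)) <= 2 * eps * (norm v + norm w) ^ 2).
{ intros eps He; destruct (HB eps He) as [d [Hd HH]].
  exists (Rmin r d); split; [now apply Rmin_pos|]; intros v w Hvw.
  assert (h1 := Rlt_le_trans _ _ _ Hvw (Rmin_l _ _)).
  assert (h2 := Rlt_le_trans _ _ _ Hvw (Rmin_r _ _)).
  assert (Nv := norm_ge_0 v); assert (Nw := norm_ge_0 w).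
  assert (hBw := blin_lin (B w : blin U V)).
  match goal with |- norm ?a <= _ => replace a with
    (minus (minus (minus (F (plus (plus x v) w)) (F (plus x v))) (app (B w) (plus x v)))
     (minus (minus (F (plus x w)) (F x)) (app (B w) x))) end.
  2:{ replace (app (B w) (plus x v)) with (plus (app (B w) x) (app (B w) v))
        by (symmetry; apply (linear_plus _ hBw)).
      module V. }
  apply (mean_value (fun z => minus (minus (F (plus z w)) (F z)) (app (B w) z)) x v
    (fun t u => minus (minus (D F (plus (plus x (scal (RtoC t : C_AbsRing) v)) w) u)
      (D F (plus x (scal (RtoC t : C_AbsRing) v)) u)) (app (B w) u))).
  { apply Rmult_le_pos; [lra|apply pow2_ge_0]. }
  intros t Ht; set (tv := scal (RtoC t : C_AbsRing) v).
  assert (Htv : norm tv <= norm v).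
  { unfold tv; rewrite norm_scal_RtoC, Rabs_pos_eq by lra; nra. }
  assert (Htw : norm (plus tv w) <= norm v + norm w).
  { apply Rle_trans with (1 := norm_triangle _ _); now apply Rplus_le_compat_r. }
  assert (Eq : plus (plus x tv) w = plus x (plus tv w)) by (module U).
  split; [|split].
  - apply is_linear_fun_minus; [apply is_linear_fun_minus; apply blin_lin|exact hBw].
  - apply fder_minus; [apply fder_minus|].
    + apply fder_shift, fder_D; rewrite Eq; apply HF; apply Rle_lt_trans with (1 := Htw); lra.
    + apply fder_D, HF; apply Rle_lt_trans with (1 := Htv); lra.
    + apply fder_linear; exact hBw.
  - rewrite Eq.
    (* By linearity of B, DF(x + tv + w) - DF(x + tv) - B(w) is the difference of the first-order
       remainders of DF at tv + w and at tv. *)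
    assert (E1 := HH (plus tv w) (Rle_lt_trans _ _ _ Htw h2)).
    assert (Hvd : norm v < d) by lra.
    assert (E2 := HH tv (Rle_lt_trans _ _ _ Htv Hvd)).
    rewrite (linear_plus _ hB) in E1.
    match type of E1 with norm ?a <= _ => match type of E2 with norm ?b <= _ =>
      replace (minus (minus (D F (plus x (plus tv w)) v) (D F (plus x tv) v)) (app (B w) v))
        with (app (minus a b) v); [assert (E3 := norm_minus_le a b)|];
      [|change (minus (minus (minus (D F (plus x (plus tv w)) v) (D F x v))
            (plus (app (B tv) v) (app (B w) v)))
          (minus (minus (D F (plus x tv) v) (D F x v)) (app (B tv) v)) =
          minus (minus (D F (plus x (plus tv w)) v) (D F (plus x tv) v)) (app (B w) v));
        module V] end end.
    apply Rle_trans with (1 := app_bound _ _).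
    apply Rle_trans with ((eps * (norm v + norm w) + eps * (norm v + norm w)) * norm v).
    2:{ replace (2 * eps * (norm v + norm w) ^ 2) with
          ((eps * (norm v + norm w) + eps * (norm v + norm w)) * (norm v + norm w)) by ring.
        apply Rmult_le_compat_l; [|lra].
        assert (0 <= eps * (norm v + norm w)) by (apply Rmult_le_pos; lra); lra. }
    apply Rmult_le_compat_r; [easy|]; apply Rle_trans with (1 := E3).
    apply Rplus_le_compat.
    + apply Rle_trans with (1 := E1); apply Rmult_le_compat_l; [lra|easy].
    + apply Rle_trans with (1 := E2); apply Rmult_le_compat_l; [lra|].
      apply Rle_trans with (1 := Htv); lra. }
intros v w; apply norm_minus_eq_0.
set (n := norm v + norm w).
assert (Nv := norm_ge_0 v); assert (Nw := norm_ge_0 w).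
assert (Nn : 0 <= n) by (unfold n; lra).
apply (le_plus_epsilon _ _ (4 * n ^ 2)); [generalize (pow2_ge_0 n); lra|]; intros eps He.
destruct (Key eps He) as [d [Hd HH]].
(* One small t suffices: main terms and errors all scale by t^2, which is divided out. *)
set (t := d / (n + 1)).
assert (Ht : 0 < t) by (apply Rdiv_lt_0_compat; lra).
assert (Htn : t * n < d).
{ apply Rlt_le_trans with (t * (n + 1)); [nra|right; unfold t; field; lra]. }
assert (Hnt : forall u : U, norm (scal (RtoC t : C_AbsRing) u) = t * norm u).
{ intros u; rewrite norm_scal_RtoC, Rabs_pos_eq; lra. }
assert (E1 := HH (scal (RtoC t : C_AbsRing) v) (scal (RtoC t : C_AbsRing) w)).
assert (E2 := HH (scal (RtoC t : C_AbsRing) w) (scal (RtoC t : C_AbsRing) v)).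
rewrite !Hnt in E1, E2.
specialize (E1 ltac:(unfold n in Htn; lra)); specialize (E2 ltac:(unfold n in Htn; lra)).
replace (plus (plus x (scal (RtoC t : C_AbsRing) w)) (scal (RtoC t : C_AbsRing) v)) with
  (plus (plus x (scal (RtoC t : C_AbsRing) v)) (scal (RtoC t : C_AbsRing) w)) in E2
  by (module U).
assert (Hs : forall a b : U, app (B (scal (RtoC t : C_AbsRing) a)) (scal (RtoC t : C_AbsRing) b)
  = scal (RtoC (t * t) : C_AbsRing) (app (B a) b)).
{ intros a b; rewrite (linear_scal _ hB).
  change (scal (RtoC t : C_AbsRing) (app (B a) (scal (RtoC t : C_AbsRing) b)) =
    scal (RtoC (t * t) : C_AbsRing) (app (B a) b)).
  replace (app (B a) (scal (RtoC t : C_AbsRing) b)) with (scal (RtoC t : C_AbsRing) (app (B a) b))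
    by (symmetry; apply (linear_scal _ (blin_lin (B a : blin U V)))).
  module_eq V; apply injective_projections; simpl; ring. }
rewrite Hs in E1, E2.
assert (Htt : 0 < t * t) by now apply Rmult_lt_0_compat.
apply Rmult_le_reg_l with (1 := Htt).
replace (t * t * norm (minus (app (B v) w) (app (B w) v))) with
  (norm (scal (RtoC (t * t) : C_AbsRing) (minus (app (B v) w) (app (B w) v))))
  by (rewrite norm_scal_RtoC, Rabs_pos_eq; lra).
match type of E1 with norm ?a <= _ => match type of E2 with norm ?b <= _ =>
  match goal with |- norm ?c <= _ => replace c with (minus a b) by (module V) end end end.
apply Rle_trans with (1 := norm_minus_le _ _).
eapply Rle_trans; [apply Rplus_le_compat; [exact E1|exact E2]|].
right; unfold n; ring.
Qed.

Lemma banach_Lk (X : NormedModule C_AbsRing) k : banach X -> banach (Lk X k).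
Proof. intros hX; induction k as [|k IH]; [easy|now apply (banach_blin X (Lk X k))]. Qed.

Lemma unit_ball_plus {X : NormedModule C_AbsRing} (x u : X) :
  norm u < 1 - norm x -> norm (plus x u) < 1.
Proof. intros H; apply Rle_lt_trans with (1 := norm_triangle _ _); lra. Qed.

(** Iterates [hol_D] with target [Lk X k], complete by [banach_Lk]; every point of the open ball has
    a neighbourhood in it, so no radius is lost. *)
Lemma hol_Dk {X : NormedModule C_AbsRing} (hX : banach X) (f : X -> X) :
  holomorphic_on unit_ball f -> forall k x, norm x < 1 -> hol (Dk k f) x.
Proof.
intros Hf; induction k as [|k IH]; intros x Hx; [now apply hol_filterdiff, Hf|].
apply (hol_D (banach_Lk X k hX) (Dk k f)).
exists (1 - norm x); split; [lra|]; intros y Hy; apply IH.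
rewrite <- (plus_minus x y); now apply unit_ball_plus.
Qed.

(** The chain rule for g o f = id near x and for f o g = id near f(x) makes Dg(f(x)) a two-sided
    inverse of Df(x). Hence the choice in [blin_inv] is a genuine inverse. *)
Lemma derivative_invertible {X : NormedModule C_AbsRing} (f : X -> X) x :
  biholomorphic_on unit_ball f -> norm x < 1 -> forall v, D f x (blin_inv (D f x) v) = v.
Proof.
intros [Hf [Ho [g [Hg Hgf]]]] Hx.
assert (Df : der f x (D f x)) by now apply der_D, hol_filterdiff, Hf.
assert (Hy : image unit_ball f (f x)) by now exists x.
assert (Dg : der g (f x) (D g (f x))) by now apply der_D, hol_filterdiff, Hg.
assert (Did : forall y : X, der (fun z => z) y (fun u => u)).
{ intros y; split; [apply is_linear_id|apply fder_linear, is_linear_id]. }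
assert (E1 : forall u, D g (f x) (D f x u) = u).
{ apply (der_unique (fun z => g (f z)) x); [now apply der_comp|].
  apply (der_ext_loc (fun z => z) _ x _ (1 - norm x)); [unfold unit_ball in *; lra| |apply Did].
  intros u Hu; symmetry; apply Hgf; now apply unit_ball_plus. }
assert (E2 : forall v, D f x (D g (f x) v) = v).
{ apply (der_unique (fun z => f (g z)) (f x)).
  - apply der_comp; [easy|]; now rewrite Hgf.
  - assert (Hl := Ho (f x) Hy).
    apply (locally_norm_le_locally (f x)) in Hl; destruct Hl as [d Hl].
    apply (der_ext_loc (fun z => z) _ (f x) _ d); [apply cond_pos| |apply Did].
    intros u Hu; destruct (Hl (plus (f x) u)) as [z [Hz Ez]].
    + change (norm (minus (plus (f x) u) (f x)) < d); now rewrite minus_plus.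
    + now rewrite <- Ez, Hgf. }
apply (epsilon_spec (inhabits (zero : blin X X)) (fun B : blin X X =>
  (forall u, B (D f x u) = u) /\ (forall v, D f x (B v) = v))).
now exists (D g (f x)).
Qed.

(** * The derivatives of h and the Fekete-Szegő mapping *)

Section Differentiation.
Variables (X : NormedModule C_AbsRing) (hX : banach X) (f h : X -> X).
Hypothesis f_hol : holomorphic_on unit_ball f.
Hypothesis h_hol : holomorphic_on unit_ball h.
Hypothesis Dfh : forall x, norm x < 1 -> D f x (h x) = f x.

Let der_k (g : X -> X) (Hg : holomorphic_on unit_ball g) k x (Hx : norm x < 1) :
  der (Dk k g) x (Dk (S k) g x : blin X (Lk X k)) := der_D _ _ (hol_Dk hX g Hg k x Hx).

(** Both sides are the derivative of f at x, so uniqueness applies. The identity is kept at every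
    point of the ball in order to be differentiated again. *)
Lemma derivative_identity_1 x u : norm x < 1 ->
  plus (app (Dk 2 f x u) (h x)) (D f x (D h x u)) = D f x u.
Proof.
intros Hx; revert u; apply (der_unique f x).
- apply (der_ext_loc (fun y => app (Dk 1 f y) (h y)) _ x _ (1 - norm x)); [lra| |].
  + intros u Hu; apply Dfh; now apply unit_ball_plus.
  + apply (der_app (Dk 1 f) h); [exact (der_k f f_hol 1 x Hx)|exact (der_k h h_hol 0 x Hx)].
- exact (der_k f f_hol 0 x Hx).
Qed.

(** The direction v is frozen and the previous identity is differentiated in x. The newest direction
    always enters the first slot of [Dk], hence [Dk 3 f x w] applied to v. *)
Lemma derivative_identity_2 x v w : norm x < 1 ->
  plus (plus (app (app (Dk 3 f x w) v) (h x)) (app (Dk 2 f x v) (D h x w)))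
    (plus (app (Dk 2 f x w) (D h x v)) (D f x (app (Dk 2 h x w) v))) = app (Dk 2 f x w) v.
Proof.
intros Hx; revert w; apply (der_unique (fun y => app (Dk 1 f y) v) x).
- apply (der_ext_loc (fun y => plus (app (app (Dk 2 f y) v) (h y))
    (app (Dk 1 f y) (app (Dk 1 h y) v))) _ x _ (1 - norm x)); [lra| |].
  + intros u Hu; apply derivative_identity_1; now apply unit_ball_plus.
  + apply der_plus.
    * apply (der_app (fun y => app (Dk 2 f y) v) h); [|exact (der_k h h_hol 0 x Hx)].
      apply (der_app_const (Dk 2 f)); exact (der_k f f_hol 2 x Hx).
    * apply (der_app (Dk 1 f) (fun y => app (Dk 1 h y) v)); [exact (der_k f f_hol 1 x Hx)|].
      apply (der_app_const (Dk 1 h)); exact (der_k h h_hol 1 x Hx).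
- apply (der_app_const (Dk 1 f)); exact (der_k f f_hol 1 x Hx).
Qed.

(** Each of the four terms of the previous identity splits in two by the product rule. The fourth
    derivative of f is paired with h(x), which vanishes at 0. *)
Lemma derivative_identity_3 x v w u : norm x < 1 ->
  plus
   (plus (plus (app (app (app (Dk 4 f x u) w) v) (h x)) (app (app (Dk 3 f x w) v) (D h x u)))
     (plus (app (app (Dk 3 f x u) v) (D h x w)) (app (Dk 2 f x v) (app (Dk 2 h x u) w))))
   (plus (plus (app (app (Dk 3 f x u) w) (D h x v)) (app (Dk 2 f x w) (app (Dk 2 h x u) v)))
     (plus (app (Dk 2 f x u) (app (Dk 2 h x w) v)) (D f x (app (app (Dk 3 h x u) w) v))))
  = app (app (Dk 3 f x u) w) v.
Proof.
intros Hx; revert u; apply (der_unique (fun y => app (app (Dk 2 f y) w) v) x).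
- apply (der_ext_loc (fun y =>
    plus (plus (app (app (app (Dk 3 f y) w) v) (h y)) (app (app (Dk 2 f y) v) (app (Dk 1 h y) w)))
    (plus (app (app (Dk 2 f y) w) (app (Dk 1 h y) v)) (app (Dk 1 f y) (app (app (Dk 2 h y) w) v))))
    _ x _ (1 - norm x)); [lra| |].
  + intros u Hu; apply derivative_identity_2; now apply unit_ball_plus.
  + assert (D2f : forall v, der (fun y => app (Dk 2 f y) v) x (fun u => app (Dk 3 f x u) v)).
    { intros v'; apply (der_app_const (Dk 2 f)); exact (der_k f f_hol 2 x Hx). }
    assert (D1h : forall v, der (fun y => app (Dk 1 h y) v) x (fun u => app (Dk 2 h x u) v)).
    { intros v'; apply (der_app_const (Dk 1 h)); exact (der_k h h_hol 1 x Hx). }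
    apply der_plus; apply der_plus.
    * apply (der_app (fun y => app (app (Dk 3 f y) w) v) h); [|exact (der_k h h_hol 0 x Hx)].
      apply (der_app_const (fun y => app (Dk 3 f y) w)), (der_app_const (Dk 3 f)).
      exact (der_k f f_hol 3 x Hx).
    * apply (der_app (fun y => app (Dk 2 f y) v) (fun y => app (Dk 1 h y) w)); easy.
    * apply (der_app (fun y => app (Dk 2 f y) w) (fun y => app (Dk 1 h y) v)); easy.
    * apply (der_app (Dk 1 f) (fun y => app (app (Dk 2 h y) w) v)); [exact (der_k f f_hol 1 x Hx)|].
      apply (der_app_const (fun y => app (Dk 2 h y) w)), (der_app_const (Dk 2 h)).
      exact (der_k h h_hol 2 x Hx).
- apply (der_app_const (fun y => app (Dk 2 f y) w)), (der_app_const (Dk 2 f)).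
  exact (der_k f f_hol 2 x Hx).
Qed.

Hypothesis h0 : h zero = zero.
Hypothesis Dh0 : forall v, D h zero v = v.
Hypothesis Df0 : forall v, D f zero v = v.

Lemma app_zero {U V : NormedModule C_AbsRing} (A : blin_NormedModule U V) : app A zero = zero.
Proof. exact (linear_zero _ (blin_lin (A : blin U V))). Qed.

Lemma norm_zero_lt_1 : norm (@zero (NormedModule.AbelianMonoid _ X)) < 1.
Proof. rewrite norm_zero; lra. Qed.

(** At 0 the second identity leaves D^2h(0)[w, v] = - D^2f(0)[v, w]; symmetry of the second
    derivative exchanges the slots. *)
Lemma second_derivative_h v w :
  app (Dk 2 h zero w) v = opp (app (Dk 2 f zero w) v).
Proof.
assert (E := derivative_identity_2 zero v w norm_zero_lt_1).
rewrite h0, app_zero, !Dh0, Df0, plus_zero_l in E.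
assert (S : app (Dk 2 f zero v) w = app (Dk 2 f zero w) v).
{ apply (second_derivative_symmetric f zero 1 (Dk 2 f zero : blin X (Lk X 1))).
  - lra.
  - intros u Hu; apply hol_filterdiff, f_hol; rewrite plus_zero_l; exact Hu.
  - exact (der_k f f_hol 1 zero norm_zero_lt_1). }
rewrite S in E.
set (a := app (Dk 2 f zero w) v) in *; set (b := app (Dk 2 h zero w) v) in *.
transitivity (minus (plus a (plus a b)) (plus a a)); [module X|rewrite E; module X].
Qed.

(** On the diagonal the terms of the third identity merge: with a = D^3f(0)[e^3] and c = D^2f(0)[e,
    D^2f(0)[e^2]] it reads 3a - 3c + D^3h(0)[e^3] = a. *)
Lemma third_derivative_h e :
  app (app (Dk 3 h zero e) e) e =
  plus (scal (RtoC (-2) : C_AbsRing) (app (app (Dk 3 f zero e) e) e))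
    (scal (RtoC 3 : C_AbsRing) (app (Dk 2 f zero e) (app (Dk 2 f zero e) e))).
Proof.
assert (E := derivative_identity_3 zero e e e norm_zero_lt_1).
rewrite h0, app_zero, !Dh0, Df0, second_derivative_h in E.
set (b := app (Dk 2 f zero e) e) in *.
assert (O : app (Dk 2 f zero e) (opp b) = opp (app (Dk 2 f zero e) b))
  by exact (linear_opp _ _ (blin_lin (Dk 2 f zero e : blin X X))).
rewrite O in E.
set (a := app (app (Dk 3 f zero e) e) e) in *.
set (c := app (Dk 2 f zero e) b) in *; set (d := app (app (Dk 3 h zero e) e) e) in *.
match type of E with ?l = _ =>
  transitivity (plus (minus l a) (plus (scal (RtoC (-2) : C_AbsRing) a) (scal (RtoC 3 : C_AbsRing) c)))
end; [module X|rewrite E; module X].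
Qed.

(** Both sides are combinations of a, c and <b, e*> b. If Lambda and M are the parameters for h, the
    coefficients of c and <b, e*> b require 1/4 - M/8 = mu/4 and Lambda - M = -2 (lambda - mu),
    which gives the values in the statement; those of a agree. *)
Lemma Psi_inverse_derivative (e : X) (es : dual X) (lam mu : C) :
  Psi e es f lam mu =
  scal (- / 2 : C_AbsRing)%C (Psi e es h (2 - 2 * lam)%C (2 - 2 * mu)%C).
Proof.
set (a := app (app (Dk 3 f zero e) e) e).
set (b := app (Dk 2 f zero e) e).
set (c := app (Dk 2 f zero e) b).
assert (Ef2 : P f 2 e = scal (/ 2 : C_AbsRing)%C b).
{ change (scal (RtoC (/ INR 2) : C_AbsRing) b = scal (/ 2 : C_AbsRing)%C b).
  f_equal; apply injective_projections; simpl; field. }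
assert (Eh2 : P h 2 e = scal (- / 2 : C_AbsRing)%C b).
{ change (scal (RtoC (/ INR 2) : C_AbsRing) (app (Dk 2 h zero e) e)
    = scal (- / 2 : C_AbsRing)%C b).
  rewrite second_derivative_h; fold b.
  module_eq X; apply injective_projections; simpl; field. }
assert (Ef3 : P f 3 e = scal (/ 6 : C_AbsRing)%C a).
{ change (scal (RtoC (/ INR 6) : C_AbsRing) a = scal (/ 6 : C_AbsRing)%C a).
  f_equal; apply injective_projections; simpl; field. }
assert (Eh3 : P h 3 e = plus (scal (- / 3 : C_AbsRing)%C a) (scal (/ 2 : C_AbsRing)%C c)).
{ change (scal (RtoC (/ INR 6) : C_AbsRing) (app (app (Dk 3 h zero e) e) e) =
    plus (scal (- / 3 : C_AbsRing)%C a) (scal (/ 2 : C_AbsRing)%C c)).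
  rewrite third_derivative_h; fold a b; fold c.
  module_eq X; apply injective_projections; simpl; field. }
assert (Hs : forall z : C, app (Dk 2 f zero e) (scal (z : C_AbsRing) b) = scal (z : C_AbsRing) c).
{ intros z; exact (linear_scal _ (blin_lin (Dk 2 f zero e : blin X X)) z b). }
assert (Ef : D2 f zero e (P f 2 e) = scal (/ 2 : C_AbsRing)%C c).
{ rewrite Ef2; apply Hs. }
assert (Eh : D2 h zero e (P h 2 e) = scal (/ 2 : C_AbsRing)%C c).
{ rewrite Eh2; change (app (Dk 2 h zero e) (scal (- / 2 : C_AbsRing)%C b)
    = scal (/ 2 : C_AbsRing)%C c).
  rewrite second_derivative_h, Hs; module X. }
assert (Ep : forall z : C, pairing (scal (z : C_AbsRing) b) es = (z * pairing b es)%C).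
{ intros z; exact (linear_scal _ (blin_lin (es : blin X C_NormedModule)) z b). }
unfold Psi; rewrite Ef, Eh, Ef2, Eh2, Ef3, Eh3, !Ep.
module_eq X; field.
Qed.

End Differentiation.

Theorem corollary5p1 (X : CompleteNormedModule C_AbsRing)
    (e : X) (es : dual X) (he : norm e = 1) (hes : J e es)
    (f : X -> X) (hf : class_Se e es f) :
  forall lam mu : C, norm (Psi e es f lam mu) <= Rmax 1 (Cmod (4 * lam - 3)).
Proof.
intros lam mu.
destruct hf as [[Hf [f0 Df0]] [Hbi [[[Hh [h0 Dh0]] _] HPsi]]].
rewrite (Psi_inverse_derivative X (banach_complete X) f _ Hf Hh) by
  (try easy; intros x Hx; now apply derivative_invertible).
rewrite norm_scal_C.
(* The bound for h is available for all complex parameters, in particular for the transformed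
   pair. *)
specialize (HPsi (2 - 2 * lam)%C (2 - 2 * mu)%C).
replace (2 * (2 - 2 * lam) - 1)%C with (- (4 * lam - 3))%C in HPsi by ring.
rewrite Cmod_opp in HPsi.
rewrite Cmod_opp, Cmod_inv, Cmod_R, Rabs_pos_eq; [lra|lra|].
intros E; apply (f_equal fst) in E; simpl in E; lra.
Qed.
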